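(* Let $k \geq 2$, let $\mathcal{I} \subseteq 2^{[k]}$ be a full antichain, let $\mathcal{J} \subseteq 2^{[k-1]}$, and let $0 < \alpha, p < 1$. For every $(\mathcal{I},\mathcal{J})$-adapted $k$-graph $F$, there exist $\mu > 0$ and $n_0$ such that the following holds. Let $H$ be an $n$-vertex $k$-graph with $n \geq n_0$ and $v(F) \mid n$. Suppose that $H$ satisfies $\texttt{Disc}^{(k)}(\mathcal{I}, \geq p, \mu)$ and that for every $x \in V(H)$ the link $L_H(x)$ satisfies $\texttt{Disc}^{(k-1)}(\mathcal{J}, \geq \alpha, \mu)$. Then $H$ has a perfect $F$-packing.
   Context: A $k$-graph is a set of $k$-element subsets (edges) of a finite vertex set; $v(H)=|V(H)|$ and $|H|$ is the number of edges. For $x\in V(H)$, the link $L_H(x)$ is the $(k-1)$-graph on vertex set $V(H)\setminus\{x\}$ whose edges are the sets $T$ with $T\cup\{x\}\in H$. An antichain is a family $\mathcal{I}\subseteq 2^{X}$ in which no member is a proper subset of another; it is full if $|\mathcal{I}|\ge 2$ and every $x\in X$ lies in some member of $\mathcal{I}$. For a family $\mathcal{I}\subseteq 2^{[k]}$ and a $k$-graph $H$, an $\mathcal{I}$-layout is a tuple $\Lambda=(\lambda_I)_{I\in\mathcal{I}}$ where each $\lambda_I$ is an $|I|$-uniform hypergraph on $V(H)$. $K_k(\Lambda)$ is the set of ordered $k$-tuples $(x_1,\dots,x_k)$ of distinct vertices such that $\{x_i:i\in I\}\in\lambda_I$ for all $I\in\mathcal{I}$, and $H\cap K_k(\Lambda)$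 is the set of such tuples with $\{x_1,\dots,x_k\}\in H$. A $k$-graph $H$ on $n$ vertices satisfies $\texttt{Disc}^{(k)}(\mathcal{I},\geq p,\mu)$ if for every $\mathcal{I}$-layout $\Lambda$, $|H\cap K_k(\Lambda)|\ge p|K_k(\Lambda)|-\mu n^k$ (for the link, $k$ is replaced by $k-1$ and $n$ by $n-1$). A $k$-graph $F$ is $\mathcal{I}$-adapted if there is an ordering $E_1,\dots,E_m$ of its edges and bijections $\phi_i:E_i\to[k]$ such that for all $1\le j<i\le m$ there is $I\in\mathcal{I}$ with $\{\phi_i(y):y\in E_j\cap E_i\}\subseteq I$. $F$ is $(\mathcal{I},\mathcal{J})$-adapted (for $\mathcal{J}\subseteq 2^{[k-1]}$) if it is $\mathcal{I}$-adapted and additionally there exist a vertex $x\in V(F)$, an ordering $E_1,\dots,E_m$ of the edges, and bijections $\psi_i:E_i\to[k]$ such that for all $1\le j<i\le m$: if $x\notin E_i$ then $\{\psi_i(y):y\in E_j\cap E_i\}\subseteq I$ for some $I\in\mathcal{I}$; if $x\in E_i$ then $\psi_i(x)=k$ and $\{\psi_i(y):y\in E_j\cap E_i, y\ne x\}\subseteq J$ for some $J\in\mathcal{J}$. A perfect $F$-packing of $H$ is a partition of $V(H)$ into vertex sets of copies of $F$ in $H$ (subhypergraphs isomorphic to $F$). *)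

(* Defs.v *)
From mathcomp Require Import all_boot all_order all_algebra.
From mathcomp Require Import reals.

Set Implicit Arguments.
Unset Strict Implicit.
Unset Printing Implicit Defensive.

Import Order.TTheory GRing.Theory Num.Theory.

(* The index set [k] = {1, ..., k} is represented by 'I_k = {0, ..., k - 1}, so
   the index k is the ordinal of value k.-1, and [k - 1] is a subset of [k]
   through [widen_ord (leq_pred k)]. *)

(* The vertex set is a subset of an ambient finite type, so that links and
   subhypergraphs live over the same type as the hypergraph itself. *)
Record kgraph (T : finType) (k : nat) := KGraph {
  verts : {set T};
  edges : {set {set T}};
  edgesP : forall e, e \in edges -> (e \subset verts) && (#|e| == k)
}.

Definition link_edges (T : finType) (k : nat) (H : kgraph T k) (x : T) :
    {set {set T}} :=
  [set e in powerset (verts H :\ x) | x |: e \in edges H].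

Lemma link_edgesP (T : finType) (k : nat) (H : kgraph T k) (x : T) e :
  e \in link_edges H x -> (e \subset verts H :\ x) && (#|e| == k.-1).
Proof.
rewrite !inE => /andP[sub /edgesP/andP[_ /eqP cardxe]]; rewrite sub /=.
have xNe : x \notin e by apply/negP => /(subsetP sub); rewrite !inE eqxx.
by rewrite cardsU1 xNe add1n in cardxe; apply/eqP/(congr1 predn cardxe).
Qed.

Definition link (T : finType) (k : nat) (H : kgraph T k) (x : T) :
    kgraph T k.-1 :=
  KGraph (@link_edgesP T k H x).

Definition antichain (X : finType) (II : {set {set X}}) : Prop :=
  forall A B, A \in II -> B \in II -> ~~ (A \proper B).

Definition full_antichain (X : finType) (II : {set {set X}}) : Prop :=
  [/\ antichain II, 2 <= #|II| & forall x : X, exists2 A, A \in II & x \in A].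

Section Discrepancy.
Variables (T : finType) (k : nat).
Implicit Types (II : {set {set 'I_k}}) (H : kgraph T k).
(* The values of a layout outside the family II are irrelevant. *)
Implicit Type lam : {set 'I_k} -> {set {set T}}.

Definition is_layout II H lam : Prop :=
  forall I, I \in II ->
  forall e, e \in lam I -> (e \subset verts H) && (#|e| == #|I|).

Definition layout_tuples II H lam : {set {ffun 'I_k -> T}} :=
  [set t : {ffun 'I_k -> T} |
    [&& injectiveb t, [forall i, t i \in verts H]
      & [forall I in II, (t @: I) \in lam I]]].

Definition layout_edges II H lam : {set {ffun 'I_k -> T}} :=
  [set t in layout_tuples II H lam | (t @: [set: 'I_k]) \in edges H].

Definition Disc (R : realType) II (p mu : R) H : Prop :=
  forall lam, is_layout II H lam ->
  (p * #|layout_tuples II H lam|%:R - mu * #|verts H|%:R ^+ k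
     <= #|layout_edges II H lam|%:R)%R.

End Discrepancy.

Section Adapted.
Variables (T : finType) (k : nat).
Implicit Type F : kgraph T k.

Definition edge_ordering F (E : 'I_#|edges F| -> {set T}) : Prop :=
  injective E /\ [set E i | i : 'I_#|edges F|] = edges F.

(* phi restricts to a bijection from e to [k]. *)
Definition labelling (e : {set T}) (phi : T -> 'I_k) : Prop :=
  {in e &, injective phi} /\ phi @: e = [set: 'I_k].

Definition adapted (II : {set {set 'I_k}}) F : Prop :=
  exists (E : 'I_#|edges F| -> {set T}) (phi : 'I_#|edges F| -> T -> 'I_k),
    [/\ edge_ordering E,
        forall i, labelling (E i) (phi i)
      & forall j i : 'I_#|edges F|, j < i ->
          exists2 I, I \in II & phi i @: (E j :&: E i) \subset I].

Definition adapted2 (II : {set {set 'I_k}}) (JJ : {set {set 'I_k.-1}}) F :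
    Prop :=
  adapted II F /\
  exists (x : T) (E : 'I_#|edges F| -> {set T})
         (psi : 'I_#|edges F| -> T -> 'I_k),
    [/\ x \in verts F,
        edge_ordering E,
        forall i, labelling (E i) (psi i)
      & forall j i : 'I_#|edges F|, j < i ->
          (x \notin E i ->
             exists2 I, I \in II & psi i @: (E j :&: E i) \subset I) /\
          (x \in E i ->
             psi i x = k.-1 :> nat /\
             exists2 J, J \in JJ &
               psi i @: ((E j :&: E i) :\ x)
                 \subset widen_ord (leq_pred k) @: J)].

End Adapted.

Definition subkgraph (T : finType) (k : nat) (G H : kgraph T k) : Prop :=
  verts G \subset verts H /\ edges G \subset edges H.

Definition kgraph_iso (S T : finType) (k : nat)
    (F : kgraph S k) (G : kgraph T k) : Prop :=
  exists f : S -> T,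
    [/\ {in verts F &, injective f}, f @: verts F = verts G
      & [set f @: (e : {set S}) | e in edges F] = edges G].

Definition perfect_packing (S T : finType) (k : nat)
    (F : kgraph S k) (H : kgraph T k) : Prop :=
  exists P : {set {set T}},
    partition P (verts H) /\
    forall B, B \in P ->
      exists G : kgraph T k, [/\ subkgraph G H, kgraph_iso F G & verts G = B].

(* Main.v *)
(* Absorption.  Averaging over random colourings of the vertices, [Disc] for
   set layouts yields [Disc] for ordered layouts; processing the edges of an
   adapted graph one at a time then gives a lower bound for the number of
   embeddings of it, a root being allowed to have a prescribed image because
   the links satisfy [Disc] as well.  The absorbing gadget of a set A of size
   f = v(F) is an f x (f - 1) array each of whose columns spans a copy of F,
   and each of whose rows spans a copy of F together with one element of A
   playing the root.  Distinct lines of the array share at most one vertex, so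
   fullness of I makes the whole gadget adapted and every A has a positive
   proportion of gadgets.  A linear number of disjoint gadgets serving every A
   many times is picked greedily; outside of them disjoint copies of F are taken
   until few vertices are left, and these are absorbed in groups of f. *)
Require Import Defs.
From mathcomp Require Import all_boot all_order all_algebra.
From mathcomp Require Import perm fingroup reals.
From mathcomp Require Import ring lra.

Set Implicit Arguments.
Unset Strict Implicit.
Unset Printing Implicit Defensive.

Import Order.TTheory GRing.Theory Num.Theory.

(** * Ordered layouts *)

(** Encodes an ordered layout: [P I] is a relation on the coordinates in [I], written as a predicate
    on whole tuples that ignores the other coordinates. *)
Definition local_family (T : finType) (k : nat)
    (P : {set 'I_k} -> pred {ffun 'I_k -> T}) : Prop :=
  forall (I : {set 'I_k}) (t t' : {ffun 'I_k -> T}), {in I, t =1 t'} -> P I t = P I t'.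

Section OrderedDisc.
Variables (T : finType) (k : nat) (H : kgraph T k) (II : {set {set 'I_k}}).
Variable P : {set 'I_k} -> pred {ffun 'I_k -> T}.
Hypothesis localP : local_family P.

Let U : {set 'I_k} := \bigcup_(I in II) I.

Let inU I i : I \in II -> i \in I -> i \in U.
Proof. by move=> II_I Ii; apply/bigcupP; exists I. Qed.

Definition ordered_tuples : {set {ffun 'I_k -> T}} :=
  [set t : {ffun 'I_k -> T} |
    [&& injectiveb t, [forall i, t i \in verts H] & [forall I in II, P I t]]].

Definition ordered_edges : {set {ffun 'I_k -> T}} :=
  [set t in ordered_tuples | (t @: [set: 'I_k]) \in edges H].

(** Only the indices in [U] are coloured: a layout on [II] puts no condition on the other positions
    and could not enforce a colour there. *)
Let coloured (c : {ffun T -> 'I_k}) (t : {ffun 'I_k -> T}) :=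
  [forall i in U, c (t i) == i].

(** A tuple of the set layout [clam c] is a coloured tuple with permuted entries; these are the
    permutations that can occur. *)
Let stab : {set {perm 'I_k}} :=
  [set s : {perm 'I_k} | [forall I in II, s @: I == I]
                         && [forall i, (i \notin U) ==> (s i == i)]].

(** The colours restore the order that an unordered edge forgets: each vertex carries its own
    index. *)
Let clam (c : {ffun T -> 'I_k}) (I : {set 'I_k}) : {set {set T}} :=
  [set e | [exists z : {ffun 'I_k -> T},
     [&& z @: I == e, [forall i in I, (z i \in verts H) && (c (z i) == i)]
       & P I z]]].

Let clam_layout c : is_layout II H (clam c).
Proof.
move=> I _ e; rewrite inE => /existsP[z /and3P[/eqP <- /forall_inP zP _]].
apply/andP; split.
  by apply/subsetP=> _ /imsetP[i Ii ->]; case/andP: (zP i Ii).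
apply/eqP; apply: card_in_imset => i j Ii Ij eq_z.
case/andP: (zP i Ii) => _ /eqP <-; case/andP: (zP j Ij) => _ /eqP <-.
by rewrite eq_z.
Qed.

Let comp (u : {perm 'I_k} * {ffun 'I_k -> T}) : {ffun 'I_k -> T} :=
  [ffun i => u.2 (u.1 i)].

Let comp_setT u : comp u @: [set: 'I_k] = u.2 @: [set: 'I_k].
Proof.
apply/setP=> x; apply/imsetP/imsetP => -[i _ ->].
  by exists (u.1 i); rewrite ?inE ?ffunE.
by exists ((u.1)^-1 i)%g; rewrite ?inE // ffunE permKV.
Qed.

Let stab_in s I i : s \in stab -> I \in II -> i \in I -> s i \in I.
Proof.
rewrite inE => /andP[/forall_inP sI _] II_I Ii.
by rewrite -(eqP (sI _ II_I)) imset_f.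
Qed.

Let coloured_tuples c := [set t in ordered_tuples | coloured c t].

(** The composite determines the permutation, which is given on [U] by the colours of the entries
    and is the identity elsewhere. *)
Let comp_inj c : {in setX stab (coloured_tuples c) &, injective comp}.
Proof.
have colE s t : (s, t) \in setX stab (coloured_tuples c) ->
    forall i, s i = if i \in U then c (comp (s, t) i) else i.
  rewrite in_setX => /andP[stab_s]; rewrite inE => /andP[_ /forall_inP ct] i.
  case: ifPn => [/bigcupP[I II_I Ii]|Ui].
    by rewrite ffunE /=; apply/esym/eqP/ct/(inU II_I)/stab_in.
  by move: stab_s; rewrite inE => /andP[_ /forallP/(_ i)/implyP/(_ Ui)/eqP].
move=> [s t] [s' t'] st st' eq_c.
have eq_s : s = s'.
  by apply/permP=> i; rewrite (colE _ _ st) (colE _ _ st') eq_c.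
subst s'; congr (_, _); apply/ffunP=> i.
by move/ffunP/(_ (s^-1 i)%g): eq_c; rewrite !ffunE /= permKV.
Qed.

Let comp_layout c :
  comp @: setX stab (coloured_tuples c) = layout_tuples II H (clam c).
Proof.
apply/setP=> x; apply/imsetP/idP => [[[s t]]|].
  rewrite in_setX => /andP[stab_s]; rewrite inE => /andP[].
  rewrite inE => /and3P[/injectiveP t_inj /forallP tV /forall_inP tP].
  move=> /forall_inP ct -> {x}; rewrite inE; apply/and3P; split.
  - by apply/injectiveP=> i j; rewrite !ffunE => /t_inj/perm_inj.
  - by apply/forallP=> i; rewrite ffunE tV.
  apply/forall_inP=> I II_I; rewrite inE; apply/existsP; exists t.
  rewrite tP // andbT; apply/andP; split; last first.
    by apply/forall_inP=> i Ii; rewrite tV ct // (inU II_I).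
  move: stab_s; rewrite inE => /andP[/forall_inP/(_ _ II_I)/eqP sI _].
  apply/eqP/setP=> y; apply/imsetP/imsetP=> -[i Ii ->].
    by move: Ii; rewrite -{1}sI => /imsetP[j Ij ->]; exists j; rewrite ?ffunE.
  by exists (s i); rewrite ?ffunE // -sI imset_f.
rewrite inE => /and3P[/injectiveP x_inj /forallP xV /forall_inP xI].
(* Reading off the colours of [x] gives the permutation by which [x] differs from a coloured
   tuple. *)
pose tau i := if i \in U then c (x i) else i.
have tauI I : I \in II -> tau @: I = I.
  move=> II_I; have := xI _ II_I; rewrite inE => /existsP[z].
  case/and3P=> /eqP zx /forall_inP zc _; apply/setP=> j.
  apply/imsetP/idP => [[i Ii ->]|Ij].
    have : x i \in z @: I by rewrite zx imset_f.
    case/imsetP=> i' Ii' xi; rewrite /tau (inU II_I Ii) xi.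
    by case/andP: (zc _ Ii') => _ /eqP->.
  have : z j \in x @: I by rewrite -zx imset_f.
  case/imsetP=> i Ii zj; exists i => //; rewrite /tau (inU II_I Ii) -zj.
  by case/andP: (zc _ Ij) => _ /eqP->.
have tau_inj : injective tau.
  have tauT : tau @: setT = setT.
    apply/setP=> j; rewrite inE; case: (boolP (j \in U)) => [|Uj].
      by case/bigcupP=> I II_I; rewrite -{1}(tauI I II_I) => /imsetP[i _ ->];
         rewrite imset_f.
    by apply/imsetP; exists j; rewrite // /tau (negPf Uj).
  have /imset_injP tau_in : #|tau @: setT| == #|[set: 'I_k]| by rewrite tauT.
  by move=> i j; apply: tau_in; rewrite inE.
pose s := perm tau_inj; pose t := [ffun i => x (s^-1 i)%g].
have tE i : t (s i) = x i by rewrite ffunE permK.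
exists (s, t); last by apply/ffunP=> i; rewrite ffunE tE.
have cx i : i \in U -> c (x i) = s i by rewrite permE /tau => ->.
rewrite in_setX; apply/andP; split.
  rewrite inE; apply/andP; split.
    apply/forall_inP=> I II_I; apply/eqP; rewrite -[RHS](tauI I II_I).
    by apply: eq_imset => i; rewrite permE.
  by apply/forallP=> i; apply/implyP=> Ui; rewrite permE /tau (negPf Ui).
rewrite inE; apply/andP; split; last first.
  apply/forall_inP=> j /bigcupP[I II_I]; rewrite -{1}(tauI I II_I).
  by case/imsetP=> i Ii ->; rewrite -[tau i](permE tau_inj) tE cx ?(inU II_I).
rewrite inE; apply/and3P; split.
- by apply/injectiveP=> i j; rewrite !ffunE => /x_inj/perm_inj.
- by apply/forallP=> i; rewrite ffunE.
apply/forall_inP=> I II_I; have := xI _ II_I; rewrite inE => /existsP[z].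
case/and3P=> /eqP zx /forall_inP zc; rewrite (localP (t' := t)) // => j Ij.
have : z j \in x @: I by rewrite -zx imset_f.
case/imsetP=> i Ii zj; rewrite zj -tE -cx ?(inU II_I) // -zj.
by case/andP: (zc _ Ij) => _ /eqP->.
Qed.

Let coloured_edges c := [set t in ordered_edges | coloured c t].

Let card_coloured c :
  #|layout_tuples II H (clam c)| = (#|stab| * #|coloured_tuples c|)%N.
Proof. by rewrite -comp_layout (card_in_imset (@comp_inj c)) cardsX. Qed.

Let coloured_edgesE c : coloured_edges c =
  [set t in coloured_tuples c | (t @: [set: 'I_k]) \in edges H].
Proof. by apply/setP=> t; rewrite !inE -!andbA; do !bool_congr. Qed.

Let card_coloured_edges c :
  #|layout_edges II H (clam c)| = (#|stab| * #|coloured_edges c|)%N.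
Proof.
have -> : layout_edges II H (clam c) = comp @: setX stab (coloured_edges c).
  rewrite coloured_edgesE /layout_edges -comp_layout.
  apply/setP=> x; rewrite inE; apply/andP/imsetP.
    case=> /imsetP[[s t] st ->]; rewrite comp_setT => tE; exists (s, t) => //.
    by move: st; rewrite !in_setX => /andP[-> st] /=; rewrite in_set st.
  case=> [[s t]]; rewrite in_setX => /andP[ss]; rewrite inE => /andP[st tE] ->.
  by rewrite comp_setT; split=> //; apply: imset_f; rewrite in_setX; apply/andP.
rewrite card_in_imset ?cardsX //; apply: sub_in2 (@comp_inj c) => -[s t].
rewrite !in_setX coloured_edgesE => /andP[-> /=].
by rewrite in_set => /andP[].
Qed.

(** The colours of the distinct vertices [t i] with [i] in [U] are forced, all the others are
    free. *)
Let card_colourings (t : {ffun 'I_k -> T}) : injective t ->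
  (#|[set c | coloured c t]| * k ^ #|U| = k ^ #|T|)%N.
Proof.
move=> t_inj.
pose G (x : T) : pred 'I_k := [pred i | [forall j in U, (t j == x) ==> (i == j)]].
have -> : [set c | coloured c t] = [set c in family G].
  apply/setP=> c; rewrite !inE; apply/forall_inP/familyP => [ct x | cG i Ui].
    apply/forall_inP=> j Uj; apply/implyP=> /eqP <-; exact: ct.
  by have /forall_inP/(_ i Ui) := cG (t i); rewrite eqxx.
rewrite cardsE card_family foldrE big_map big_enum /=.
have GE x : #|G x| = if x \in t @: U then 1%N else k.
  case: ifPn => [/imsetP[j Uj ->]|xU].
    rewrite -(card1 j); apply: eq_card => i; rewrite !inE.
    apply/forall_inP/eqP => [/(_ j Uj)|->]; first by rewrite eqxx => /eqP.
    by move=> j' _; apply/implyP=> /eqP/t_inj->.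
  rewrite -[RHS]card_ord; apply: eq_card => i; rewrite !inE.
  apply/forall_inP=> j Uj; apply/implyP=> /eqP tj.
  by rewrite -tj imset_f in xU.
rewrite (eq_bigr _ (fun x _ => GE x)) (bigID [in t @: U]) /=.
rewrite big1 => [|x ->//]; rewrite mul1n.
rewrite (eq_bigr (fun=> k)) => [|x /negPf->//].
rewrite prod_nat_const -(card_imset [in U] t_inj) -expnD.
congr (_ ^ _)%N; rewrite addnC -(cardC [in t @: U]) /=.
by congr (_ + _)%N; apply: eq_card => x; rewrite !inE.
Qed.

(** Apply [Disc] to [clam c] for every colouring [c], divide by [#|stab| >= 1], and sum. Each tuple
    is properly coloured by the fraction [k ^- #|U|] of all colourings, whence the loss of at most
    [k ^ k] in the error. *)
Lemma Disc_ordered (R : realType) (p mu : R) :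
  (0 < k)%N -> (0 <= mu)%R -> Disc II p mu H ->
  (p * #|ordered_tuples|%:R - mu * (k ^ k)%:R * #|verts H|%:R ^+ k
    <= #|ordered_edges|%:R)%R.
Proof.
move=> k_gt0 mu_ge0 discH; set n : R := (_ ^+ k)%R.
have n_ge0 : (0 <= n)%R by rewrite exprn_ge0.
have step c : (p * #|coloured_tuples c|%:R - mu * n <= #|coloured_edges c|%:R)%R.
  have := discH _ (@clam_layout c); rewrite card_coloured card_coloured_edges.
  have stab_gt0 : (0 < #|stab|)%N.
    apply/card_gt0P; exists 1%g; rewrite inE; apply/andP; split.
      apply/forall_inP=> I _; apply/eqP; rewrite -[RHS]imset_id.
      by apply: eq_imset => i; rewrite perm1.
    by apply/forallP=> i; rewrite perm1 eqxx implybT.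
  rewrite !natrM -/n => le1.
  have s1 : (1 <= #|stab|%:R :> R)%R by rewrite ler1n.
  have s0 : (0 < #|stab|%:R :> R)%R by rewrite ltr0n.
  rewrite -(ler_pM2l s0); apply: le_trans le1.
  rewrite mulrBr lerB //; first by rewrite mulrCA.
  by rewrite ler_peMl // mulr_ge0.
have sumcard (A : {set {ffun 'I_k -> T}}) :
    (forall t : {ffun 'I_k -> T}, t \in A -> injective t) ->
    ((\sum_c #|[set t in A | coloured c t]|) * k ^ #|U| = #|A| * k ^ #|T|)%N.
  move=> A_inj.
  under eq_bigr do rewrite -sum1dep_card.
  rewrite (exchange_big_dep [in A]) /= => [|c t _ /andP[]//].
  rewrite big_distrl /= -sum_nat_const; apply: eq_bigr => t At.
  under eq_bigl do rewrite At.
  rewrite sum1dep_card; exact/card_colourings/A_inj.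
have le_sum : (p * (\sum_c #|coloured_tuples c|)%:R - mu * n * (k ^ #|T|)%:R
    <= (\sum_c #|coloured_edges c|)%:R)%R.
  rewrite !natr_sum mulr_sumr; apply: le_trans (ler_sum _ (fun c _ => step c)).
  by rewrite sumrB sumr_const card_ffun card_ord mulr_natr.
have inj1 : forall t : {ffun 'I_k -> T}, t \in ordered_tuples -> injective t.
  by move=> t; rewrite inE => /and3P[/injectiveP].
have inj2 : forall t : {ffun 'I_k -> T}, t \in ordered_edges -> injective t.
  by move=> t; rewrite inE => /andP[/inj1].
have kT : (0 < (k ^ #|T|)%:R :> R)%R by rewrite ltr0n expn_gt0 k_gt0.
have kU : (0 < (k ^ #|U|)%:R :> R)%R by rewrite ltr0n expn_gt0 k_gt0.
have le_kU : ((k ^ #|U|)%:R <= (k ^ k)%:R :> R)%R.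
  by rewrite ler_nat leq_pexp2l // (leq_trans (max_card _)) ?card_ord.
rewrite -(ler_pM2r kT) -natrM -(sumcard _ inj2) natrM.
apply: le_trans (ler_wpM2r (ltW kU) le_sum).
have eqA : (p * ((\sum_c #|coloured_tuples c|)%:R * (k ^ #|U|)%:R)
    = p * (#|ordered_tuples|%:R * (k ^ #|T|)%:R))%R.
  by rewrite -!natrM (sumcard _ inj1).
have := ler_wpM2l (mulr_ge0 (mulr_ge0 mu_ge0 n_ge0) (ltW kT)) le_kU.
clear - eqA; move: eqA n.
move: (k ^ #|U|)%:R%R (k ^ #|T|)%:R%R (k ^ k)%:R%R => u v w.
move: (\sum_c _)%:R%R #|ordered_tuples|%:R%R => a b eqA n le_w.
rewrite [leRHS]mulrBl -[(p * a * u)%R]mulrA eqA mulrBl mulrA lerD2l lerN2.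
by have -> : (mu * w * n * v = mu * n * v * w)%R by ring.
Qed.

End OrderedDisc.

(** * Counting embeddings *)

Lemma card_exists_le (I X : finType) (Q : I -> pred X) :
  #|[set x | [exists i, Q i x]]| <= \sum_i #|[set x | Q i x]|.
Proof.
under [leqRHS]eq_bigr do rewrite -sum1dep_card.
rewrite (exchange_big_dep predT) //= -sum1dep_card.
rewrite [leqRHS](bigID (fun x => [exists i, Q i x])) /= -[leqLHS]addn0.
apply: leq_add => //; apply: leq_sum => x /existsP[i Qi].
by rewrite (bigD1 i).
Qed.

(** * Rare maps: non-injective ones and those hitting a small set *)

Section MapCounts.
Variables (Y T : finType) (V : {set T}).
Implicit Type g : {ffun Y -> T}.

(** Overwriting the value at [y] of a map in [B] by any element of [V] is an injective operation on
    such pairs. *)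
Lemma card_determined (B : {set {ffun Y -> T}}) y :
  {subset B <= ffun_on V} ->
  {in B &, forall g g', (forall z, z != y -> g z = g' z) -> g = g'} ->
  #|B| * #|V| <= #|V| ^ #|Y|.
Proof.
move=> BV Bdet.
pose h (u : {ffun Y -> T} * T) := [ffun z => if z == y then u.2 else u.1 z].
rewrite -cardsX -card_ffun_on -(card_in_imset (f := h)).
  apply/subset_leq_card/subsetP=> x /imsetP[[g v]].
  rewrite in_setX => /andP[/BV/ffun_onP gV Vv] ->{x}.
  by apply/ffun_onP=> z; rewrite ffunE; case: eqP.
move=> [g v] [g' v']; rewrite !in_setX => /andP[Bg _] /andP[Bg' _] /ffunP eqh.
congr (_, _).
  by apply: Bdet => // z zy; have := eqh z; rewrite !ffunE (negPf zy).
by have := eqh y; rewrite !ffunE eqxx.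
Qed.

Lemma card_not_injective :
  #|[set g : {ffun Y -> T} in ffun_on V | ~~ injectiveb g]| * #|V|
    <= #|Y| ^ 2 * #|V| ^ #|Y|.
Proof.
pose Q (u : Y * Y) : pred {ffun Y -> T} :=
  fun g => [&& g \in ffun_on V, u.1 != u.2 & g u.1 == g u.2].
apply: (@leq_trans ((\sum_u #|[set g | Q u g]|) * #|V|)).
  rewrite leq_mul2r; apply/orP; right; apply: leq_trans (card_exists_le _).
  apply/subset_leq_card/subsetP=> g; rewrite !inE => /andP[gV].
  move=> /injectivePn[y [z yz gyz]]; apply/existsP; exists (y, z).
  by rewrite /Q; apply/and3P; split=> //; apply/eqP.
rewrite big_distrl /= -mulnn -card_prod -sum_nat_const.
apply: leq_sum => -[y z] _; case: (eqVneq y z) => [->|yz].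
  rewrite (_ : [set _ | _] = set0) ?cards0 //.
  by apply/setP=> g; rewrite !inE /Q /= eqxx andbF.
apply: (card_determined (y := y)) => [g|g g']; first by rewrite in_set => /andP[].
rewrite !in_set => /and3P[_ _ /eqP gyz] /and3P[_ _ /eqP gyz'] eqg.
apply/ffunP=> w; case: (eqVneq w y) => [->|/eqg//].
by rewrite gyz gyz' eqg // eq_sym.
Qed.

Lemma card_hitting (U : {set T}) :
  #|[set g : {ffun Y -> T} in ffun_on V | [exists y, g y \in U]]| * #|V|
    <= #|Y| * #|U| * #|V| ^ #|Y|.
Proof.
pose Q (u : Y * T) : pred {ffun Y -> T} :=
  fun g => [&& g \in ffun_on V, u.2 \in U & g u.1 == u.2].
apply: (@leq_trans ((\sum_u #|[set g | Q u g]|) * #|V|)).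
  rewrite leq_mul2r; apply/orP; right; apply: leq_trans (card_exists_le _).
  apply/subset_leq_card/subsetP=> g; rewrite !inE => /andP[gV].
  move=> /existsP[y Uy]; apply/existsP; exists (y, g y).
  by rewrite /Q; apply/and3P; split.
rewrite big_distrl /= -[X in X * #|U| * _]cardsT -cardsX -sum_nat_const.
rewrite (bigID [in setX [set: Y] U]) /= [X in _ + X]big1 ?addn0.
  apply: leq_sum => -[y v] _.
  apply: (card_determined (y := y)) => [g|g g'].
    by rewrite in_set => /andP[].
  rewrite !in_set => /and3P[_ _ /eqP gy] /and3P[_ _ /eqP gy'] eqg.
  by apply/ffunP=> w; case: (eqVneq w y) => [->|/eqg//]; rewrite gy gy'.
move=> [y v]; rewrite in_setX in_setT /= => /negPf Uv.
rewrite (_ : [set _ | _] = set0) ?cards0 ?mul0n //.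
by apply/setP=> g; rewrite in_set in_set0 /Q /= Uv andbF.
Qed.

End MapCounts.

(* [Disc] for ordered layouts and for maps that need not be injective, with
   the error measured relative to the host set [V]. *)
Definition odisc (R : realType) (T : finType) (k : nat)
    (fam : {set {set 'I_k}}) (q eta : R) (V : {set T}) (E : {set {set T}}) :=
  forall P : {set 'I_k} -> pred {ffun 'I_k -> T}, local_family P ->
  (q * #|[set t in ffun_on V | [forall I in fam, P I t]]|%:R
     - eta * (#|V| ^ k)%:R
   <= #|[set t in ffun_on V | [forall I in fam, P I t]
                              & (t @: [set: 'I_k]) \in E]|%:R)%R.

(** * Transfer of discrepancy, and counting by one constraint at a time *)

Section OdiscTheory.
Variables (R : realType) (T : finType).
Implicit Types (V W : {set T}) (E : {set {set T}}) (q eta p mu : R).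
Local Open Scope ring_scope.

(** The spare vertex allowed in [V] lets a link, which omits its root, be hosted on the whole vertex
    set. In the error, [k ^ 2] pays for the non-injective tuples and [k] for those using the spare
    vertex. *)
Lemma Disc_odisc k (H : kgraph T k) (fam : {set {set 'I_k}}) p mu V :
  (0 < k)%N -> 0 <= mu -> 0 <= p <= 1 -> Disc fam p mu H ->
  verts H \subset V -> (#|V :\: verts H| <= 1)%N -> (0 < #|V|)%N ->
  odisc fam p (mu * (k ^ k)%:R + (k ^ 2 + k)%:R / #|V|%:R) V (edges H).
Proof.
move=> k0 mu0 /andP[p0 p1] discH HV cVH V0 P localP.
have := Disc_ordered localP k0 mu0 discH.
set ot := ordered_tuples _ _ _; set oe := ordered_edges _ _ _ => le_ot.
set A := [set t in _ | _]; set B := [set t in _ | _ & _].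
set N1 := [set t : {ffun 'I_k -> T} in ffun_on V | ~~ injectiveb t].
set N2 := [set t : {ffun 'I_k -> T} in ffun_on V
             | [exists i, t i \in V :\: verts H]].
have VR : 0 < #|V|%:R :> R by rewrite ltr0n.
have leN1 : #|N1|%:R <= (k ^ 2)%:R / #|V|%:R * (#|V| ^ k)%:R :> R.
  rewrite mulrAC ler_pdivlMr // -!natrM ler_nat.
  by have := card_not_injective 'I_k V; rewrite card_ord.
have leN2 : #|N2|%:R <= k%:R / #|V|%:R * (#|V| ^ k)%:R :> R.
  rewrite mulrAC ler_pdivlMr // -!natrM ler_nat.
  have := card_hitting 'I_k V (V :\: verts H); rewrite card_ord => /leq_trans->//.
  by rewrite leq_mul // -[leqRHS]muln1 leq_mul2l cVH orbT.
have leA : #|A|%:R <= #|ot|%:R + #|N1|%:R + #|N2|%:R :> R.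
  rewrite -!natrD ler_nat.
  apply: leq_trans (leq_trans (leq_card_setU (ot :|: N1) N2) _); last first.
    by rewrite leq_add2r leq_card_setU.
  apply/subset_leq_card/subsetP=> t; rewrite !in_set => /andP[tV tP].
  rewrite tV tP /= andbT; case: (boolP (injectiveb t)) => //= _.
  case: (boolP [forall i, _]) => //= /forallPn[i tNH].
  by apply/existsP; exists i; rewrite in_setD tNH; exact: (ffun_onP tV).
have leB : #|oe|%:R <= #|B|%:R :> R.
  rewrite ler_nat; apply/subset_leq_card/subsetP=> t; rewrite !inE.
  case/andP=> /and3P[_ /forallP tH ->] -> /=; rewrite andbT.
  by apply/ffun_onP=> i; apply: (subsetP HV).
have leH : #|verts H|%:R ^+ k <= (#|V| ^ k)%:R :> R.
  by rewrite natrX lerXn2r ?nnegrE // ler_nat subset_leq_card.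
apply: le_trans leB; apply: le_trans le_ot.
have pA : p * #|A|%:R <= p * #|ot|%:R + (#|N1|%:R + #|N2|%:R).
  apply: le_trans (ler_wpM2l p0 leA) _.
  by rewrite -addrA mulrDr lerD2l ler_piMl // addr_ge0.
have muH := ler_wpM2l (mulr_ge0 mu0 (ler0n R (k ^ k))) leH.
rewrite mulrDl natrD !mulrDl.
move: pA leN1 leN2 muH; clear.
move: (_ ^+ k) (#|V| ^ k)%:R (k ^ k)%:R #|A|%:R #|ot|%:R #|N1|%:R #|N2|%:R.
move: (k ^ 2)%:R k%:R #|V|%:R^-1 => a b v vH vV kk A' ot' N1' N2'.
by lra.
Qed.

Lemma odisc_weaken k (fam : {set {set 'I_k}}) q q' eta eta' V E :
  odisc fam q eta V E -> q' <= q -> eta <= eta' -> odisc fam q' eta' V E.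
Proof.
move=> od leq leeta P localP; apply: le_trans (od P localP).
by apply: lerB; apply: ler_wpM2r.
Qed.

(** A relation indexed by the empty set holds for all tuples or for none. With [set0] available, a
    constraint disjoint from the current edge has an index even when [fam] is empty. *)
Lemma odisc_set0 k (fam : {set {set 'I_k}}) q eta V E :
  0 <= eta -> odisc fam q eta V E -> odisc (set0 |: fam) q eta V E.
Proof.
move=> eta0 od P localP.
have P0 t t' : P set0 t = P set0 t' by apply: localP => i; rewrite inE.
have allE t : [forall I in set0 |: fam, P I t] =
    P set0 t && [forall I in fam, P I t].
  apply/forall_inP/andP => [PI|[Pt /forall_inP PI] I].
    split; first by apply: PI; rewrite setU11.
    by apply/forall_inP=> I fI; apply: PI; rewrite setU1r.
  by case/setU1P=> [->|/PI].
case: (boolP [exists t, P set0 t]) => [/existsP[t0 Pt0]|/existsPn Pn].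
  have Pt t : P set0 t by rewrite (P0 t t0).
  have {}allE t : [forall I in set0 |: fam, P I t] = [forall I in fam, P I t].
    by rewrite allE Pt.
  under eq_finset do rewrite allE.
  by under [in leRHS]eq_finset do rewrite allE; apply: od.
rewrite (_ : [set t in _ | _] = set0) ?cards0.
  by rewrite mulr0 sub0r; apply: le_trans (ler0n _ _); rewrite oppr_le0 mulr_ge0.
by apply/setP=> t; rewrite !inE allE (negPf (Pn t)) andbF.
Qed.

(** As [fam] covers all coordinates, membership in [W] can be made part of the local relations; only
    the normalisation of the error changes. *)
Lemma odisc_subset k (fam : {set {set 'I_k}}) q eta eta' V W E :
  (forall i, exists2 I, I \in fam & i \in I) -> W \subset V ->
  eta * (#|V| ^ k)%:R <= eta' * (#|W| ^ k)%:R ->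
  odisc fam q eta V E -> odisc fam q eta' W E.
Proof.
move=> full WV le_eta od P localP.
pose P' (I : {set 'I_k}) : pred {ffun 'I_k -> T} :=
  [pred t | P I t && [forall i in I, t i \in W]].
have localP' : local_family P'.
  move=> I t t' eqt; rewrite /P' /= (localP _ _ _ eqt); congr (_ && _).
  by apply: eq_forallb_in => i Ii; rewrite eqt.
have P'E t : (t \in ffun_on V) && [forall I in fam, P' I t] =
    (t \in ffun_on W) && [forall I in fam, P I t].
  apply/andP/andP=> -[/ffun_onP tV /forall_inP PI].
    split; last by apply/forall_inP=> I /PI/andP[].
    apply/ffun_onP=> i; have [I fI Ii] := full i.
    by case/andP: (PI I fI) => _ /forall_inP; apply.
  split; first by apply/ffun_onP=> i; apply: (subsetP WV).
  by apply/forall_inP=> I fI; rewrite /P' /= PI //=; apply/forall_inP.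
have := od P' localP'.
rewrite (_ : [set t in _ | _] = [set t in ffun_on W | [forall I in fam, P I t]]);
  last by apply/setP=> t; rewrite !inE P'E.
rewrite (_ : [set t in _ | _ & _] = [set t in ffun_on W |
    [forall I in fam, P I t] & (t @: [set: 'I_k]) \in E]);
  last by apply/setP=> t; rewrite !inE !andbA P'E.
by apply: le_trans; rewrite lerB.
Qed.

Section Update.
Variables (Y : finType) (k : nat) (e : 'I_k -> Y).
Hypothesis e_inj : injective e.

Definition upd (g : {ffun Y -> T}) (t : {ffun 'I_k -> T}) : {ffun Y -> T} :=
  [ffun y => if [pick i | e i == y] is Some i then t i else g y].

Lemma upd_in g t i : upd g t (e i) = t i.
Proof.
rewrite ffunE; case: pickP => [j /eqP/e_inj->//|/(_ i)]; by rewrite eqxx.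
Qed.

Lemma upd_out g t y : (forall i, e i != y) -> upd g t y = g y.
Proof.
by move=> ye; rewrite ffunE; case: pickP => [j|//]; rewrite (negPf (ye j)).
Qed.

(** Double counting: exchanging the values of [g] along [e] with [t] is an involution on pairs. *)
Lemma sum_card_upd V (A : {set {ffun Y -> T}}) : {subset A <= ffun_on V} ->
  (\sum_(g in ffun_on V) #|[set t in ffun_on V | upd g t \in A]|
    = #|A| * #|V| ^ k)%N.
Proof.
move=> AV.
pose swap (u : {ffun Y -> T} * {ffun 'I_k -> T}) :=
  (upd u.1 u.2, [ffun i => u.1 (e i)] : {ffun 'I_k -> T}).
have swapK : involutive swap.
  move=> [g t]; congr (_, _); apply/ffunP=> y /=; last by rewrite ffunE upd_in.
  case: (pickP (fun i => e i == y)) => [i /eqP <-|ye].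
    by rewrite upd_in ffunE.
  by rewrite !upd_out // => i; rewrite ye.
pose X := setX A [set t : {ffun 'I_k -> T} in ffun_on V].
have -> : (#|A| * #|V| ^ k)%N = #|swap @^-1: X|.
  rewrite (card_preimset _ (can_inj swapK)) cardsX; congr (_ * _)%N.
  by rewrite cardsE card_ffun_on card_ord.
under eq_bigr do rewrite -sum1dep_card.
rewrite pair_big_dep /= sum1dep_card; apply: eq_card => -[g t].
rewrite !inE /=; apply/andP/andP => [[gV /andP[tV Ag]]|[Ag tV]].
  by split=> //; apply/ffun_onP=> i; rewrite ffunE (ffun_onP gV).
have uV := ffun_onP (AV _ Ag); rewrite Ag andbT; split.
  apply/ffun_onP=> y; case: (pickP (fun i => e i == y)) => [i /eqP <-|ye].
    by have := ffun_onP tV i; rewrite ffunE.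
  by rewrite -(upd_out g t) // => i; rewrite ye.
by apply/ffun_onP=> i; rewrite -(upd_in g t).
Qed.

Lemma count_step (fam : {set {set 'I_k}}) q eta V E (A : {set {ffun Y -> T}}) :
  (0 < #|V|)%N -> odisc fam q eta V E -> {subset A <= ffun_on V} ->
  (forall g, g \in ffun_on V ->
     exists P : {set 'I_k} -> pred {ffun 'I_k -> T}, local_family P /\
       {in ffun_on V, forall t, (upd g t \in A) = [forall I in fam, P I t]}) ->
  q * #|A|%:R - eta * (#|V| ^ #|Y|)%:R
    <= #|[set g in A | [set g (e i) | i : 'I_k] \in E]|%:R.
Proof.
move=> V0 od AV AP; set A' := [set g in A | _].
have A'V : {subset A' <= ffun_on V} by move=> g; rewrite inE => /andP[/AV].
have Vk : 0 < (#|V| ^ k)%:R :> R by rewrite ltr0n expn_gt0 V0.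
rewrite -(ler_pM2r Vk) mulrBl -!mulrA -!natrM.
rewrite -(sum_card_upd AV) -(sum_card_upd A'V).
have -> : (#|V| ^ #|Y| * #|V| ^ k =
    \sum_(g : {ffun Y -> T} | g \in ffun_on V) #|V| ^ k)%N.
  by rewrite sum_nat_const card_ffun_on.
rewrite !natr_sum !mulr_sumr.
rewrite -sumrB; apply: ler_sum => g gV.
have [P [localP PE]] := AP g gV.
have -> : [set t in ffun_on V | upd g t \in A] =
    [set t in ffun_on V | [forall I in fam, P I t]].
  by apply/setP=> t; rewrite !in_set; case: (boolP (t \in ffun_on V)) => //= /PE->.
have -> : [set t in ffun_on V | upd g t \in A'] =
    [set t in ffun_on V | [forall I in fam, P I t] & (t @: [set: 'I_k]) \in E].
  apply/setP=> t; rewrite !in_set; case: (boolP (t \in ffun_on V)) => //= /PE->.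
  suff -> : [set upd g t (e i) | i : 'I_k] = t @: [set: 'I_k] by [].
  by apply/setP=> v; apply/imsetP/imsetP=> -[i _ ->]; exists i; rewrite ?upd_in.
exact: od.
Qed.

End Update.

(** Each constraint costs one factor [q] and one error [eta]. Its uniformity [k] and its host [E]
    may vary with [j], so that edges of [H] and edges of links can be mixed. *)
Lemma count_embed (Y J : finType) V q eta (Z : J -> {set Y})
    (C : J -> pred {ffun Y -> T}) (rank : J -> nat) :
  0 <= q <= 1 -> 0 <= eta -> (0 < #|V|)%N ->
  (forall j (g g' : {ffun Y -> T}), {in Z j, g =1 g'} -> C j g = C j g') ->
  (forall j, exists k (e : 'I_k -> Y) (fam : {set {set 'I_k}}) E,
     [/\ injective e, odisc fam q eta V E,
         forall g, C j g = ([set g (e i) | i : 'I_k] \in E)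
       & forall j', j' != j -> (rank j' <= rank j)%N ->
           exists2 I, I \in fam & forall i, e i \in Z j' -> i \in I]) ->
  q ^+ #|J| * (#|V| ^ #|Y|)%:R - #|J|%:R * eta * (#|V| ^ #|Y|)%:R
    <= #|[set g in ffun_on V | [forall j, C j g]]|%:R.
Proof.
move=> /andP[q0 q1] eta0 V0 CZ Cstep; set N := (_ ^ _)%:R.
have N0 : 0 <= N by rewrite ler0n.
pose A (D : {set J}) := [set g in ffun_on V | [forall j in D, C j g]].
suff main m (D : {set J}) : #|D| = m ->
    q ^+ m * N - m%:R * eta * N <= #|A D|%:R.
  have := main _ _ (cardsT J); congr (_ <= #|pred_of_set _|%:R).
  by apply/setP=> g; rewrite !inE; congr (_ && _); apply: eq_forallb => j; rewrite inE.
elim: m D => [|m IHm] D cD.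
  rewrite expr0 mul1r !mul0r subr0 ler_nat -(card_ffun_on Y [in V]).
  apply/subset_leq_card/subsetP=> g gV; rewrite inE gV; apply/forall_inP=> j.
  by rewrite (cards0_eq cD) inE.
have /card_gt0P[j0 Dj0] : (0 < #|D|)%N by rewrite cD.
(* The constraint of largest rank is imposed last, so the trace condition covers all the remaining
   ones. *)
case: (arg_maxnP rank Dj0) => j Dj0' jmax; have Dj : j \in D := Dj0'.
have cD' : #|D :\ j| = m by have := cardsD1 j D; rewrite Dj cD => -[].
have {IHm} := IHm _ cD'.
have [k [e [fam [E [e_inj od CE jfam]]]]] := Cstep j.
have AV : {subset A (D :\ j) <= ffun_on V} by move=> g; rewrite inE => /andP[].
have -> : A D = [set g in A (D :\ j) | [set g (e i) | i : 'I_k] \in E].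
  apply/setP=> g; rewrite !inE -andbA -CE; congr (_ && _).
  apply/forall_inP/andP => [Cg|[/forall_inP Cg Cj] j' Dj'].
    by split; [apply/forall_inP=> j' /setD1P[_ /Cg]|apply: Cg].
  by case: (eqVneq j' j) => [->//|j'j]; apply: Cg; rewrite !inE j'j.
move=> IH; apply: le_trans (count_step e_inj V0 od AV _).
  have : q * (q ^+ m * N - m%:R * eta * N) <= q * #|A (D :\ j)|%:R.
    by rewrite ler_wpM2l.
  rewrite -/N exprS mulrSr.
  have : q * (m%:R * eta * N) <= m%:R * eta * N.
    by rewrite ler_piMl // !mulr_ge0.
  clear; move: N #|A (D :\ j)|%:R (q ^+ m) m%:R => N a b c.
  by lra.
(* [P I] collects the remaining constraints whose trace on the current edge lies in [I]; each of
   them is collected by some [I] of the family. *)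
move=> g gV; exists (fun (I : {set 'I_k}) (t : {ffun 'I_k -> T}) =>
  [forall j' in D :\ j, [forall i, (e i \in Z j') ==> (i \in I)] ==> C j' (upd e g t)]); split.
  move=> I t t' eqt /=; apply: eq_forallb_in => j' _.
  case: (boolP [forall i, _]) => //= /forallP ZI; apply: CZ => y Zy.
  case: (pickP (fun i => e i == y)) => [i /eqP ei|ye]; last first.
    by rewrite !upd_out // => i; rewrite ye.
  by rewrite -ei !upd_in // eqt //; apply: (implyP (ZI i)); rewrite ei.
move=> t tV; rewrite inE.
have -> /= : upd e g t \in ffun_on V.
  apply/ffun_onP=> y; rewrite ffunE.
  by case: pickP => *; [apply: (ffun_onP tV)|apply: (ffun_onP gV)].
apply/forall_inP/forall_inP => [Cu I fI|Cu j' Dj'].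
  by apply/forall_inP=> j' /Cu->; rewrite implybT.
have [j'j Dj''] := setD1P Dj'.
have [I fI ZI] := jfam _ j'j (jmax _ Dj'').
have /= /forall_inP/(_ _ Dj')/implyP := Cu I fI; apply.
by apply/forallP=> i; apply/implyP/ZI.
Qed.

End OdiscTheory.

(** * Absorbing families *)

Section GreedyFamily.
Variables (R : realType) (O A T : finType) (supp : O -> {set T}).
Variables (abs : O -> A -> bool) (O0 : {set O}) (A0 : {set A}).
Variables (N t b : nat) (delta : R).
Hypotheses (N_gt0 : 0 < N) (O0_le : #|O0| <= N) (delta_gt0 : (0 < delta)%R)
           (delta_le1 : (delta <= 1)%R).
Hypotheses (supp_neq0 : forall w, supp w != set0)
           (supp_le : forall w, #|supp w| <= t).
Hypothesis many : forall (U : {set T}) a, #|U| <= b -> a \in A0 ->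
  (delta * N%:R
     <= #|[set w in O0 | abs w a && [disjoint supp w & U]]|%:R)%R.
Local Open Scope ring_scope.

(* Conditional expectations: each new member of the family is chosen so that
   the potential [sum_a 2^(- number of members absorbing a)] drops by a factor
   [1 - delta / 2], so no target can be left with few absorbers. *)
Lemma greedy_family s : (s * t <= b)%N ->
  exists M : {set O},
    [/\ M \subset O0, {in M &, forall v w, v != w -> [disjoint supp v & supp w]},
        (#|\bigcup_(w in M) supp w| <= s * t)%N
      & \sum_(a in A0) 2^-1 ^+ #|[set w in M | abs w a]|
          <= #|A0|%:R * (1 - delta / 2) ^+ s].
Proof.
elim: s => [|s IHs] lesb.
  exists set0; split=> [|v w||]; rewrite ?sub0set ?inE ?big_set0 ?cards0 //.
  rewrite expr0 mulr1 -sumr_const ler_sum // => a _.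
  by rewrite (_ : [set _ in _ | _] = set0) ?cards0 //; apply/setP=> w; rewrite !inE.
have [|M [MO Mdisj]] := IHs.
  by apply: leq_trans lesb; rewrite leq_mul2r leqnSn orbT.
set U := \bigcup_(w in M) supp w => cU.
pose pot a : R := 2^-1 ^+ #|[set w in M | abs w a]|.
rewrite -/(\sum_(a in A0) pot a); set S := \sum_(a in A0) pot a => leS.
have leUb : (#|U| <= b)%N.
  by apply: leq_trans (leq_trans cU _) lesb; rewrite leq_mul2r leqnSn orbT.
have pot_gt0 a : 0 < pot a by rewrite exprn_gt0 // invr_gt0.
case: (set_0Vmem A0) => [A00|[a0 A0a0]].
  exists M; split=> //; first by apply: leq_trans cU _; rewrite leq_mul2r leqnSn orbT.
  by rewrite A00 big_set0 cards0 mul0r.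
have S_gt0 : 0 < S.
  rewrite /S (bigD1 a0) //= ltr_pwDl // sumr_ge0 // => a _; exact: ltW.
pose O1 := [set w in O0 | [disjoint supp w & U]].
pose gain w := \sum_(a in A0 | abs w a) pot a.
have O1E a : [set w in O0 | abs w a && [disjoint supp w & U]] =
    [set w in O1 | abs w a].
  by apply/setP=> w; rewrite !inE -andbA; congr (_ && _); rewrite andbC.
have NR : 0 < N%:R :> R by rewrite ltr0n.
have sum_gain : delta * S * N%:R <= \sum_(w in O1) gain w.
  rewrite /gain (exchange_big_dep [in A0]) /= => [|w a _ /andP[]//].
  rewrite /S mulr_sumr mulr_suml; apply: ler_sum => a A0a.
  rewrite (eq_bigl [in [set w in O1 | abs w a]]); last first.
    by move=> w; rewrite !inE A0a.
  rewrite sumr_const -O1E -[leRHS]mulr_natr.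
  rewrite [leLHS](_ : _ = pot a * (delta * N%:R)); last by ring.
  by rewrite ler_wpM2l ?many // ltW.
have O1_le : (#|O1| <= N)%N.
  apply: leq_trans O0_le; apply/subset_leq_card/subsetP=> w.
  by rewrite inE => /andP[].
have [w0 O1w0] : exists w, w \in O1.
  apply/set0Pn; apply: contraTneq sum_gain => ->.
  by rewrite big_set0 -ltNge !mulr_gt0.
(* There are at most [N] candidates and their gains add up to at least [delta * S * N], so one of
   them reaches the average. *)
have [w O1w gain_w] : exists2 w, w \in O1 & delta * S <= gain w.
  apply/exists_inP; apply: contraTT sum_gain => /exists_inPn small.
  rewrite -ltNge; apply: (@lt_le_trans _ _ (\sum_(w in O1) delta * S)).
    rewrite (bigD1 w0) //= [ltRHS](bigD1 w0) //= ltr_leD //.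
      by rewrite ltNge small.
    by apply: ler_sum => w /andP[/small]; rewrite -ltNge => /ltW.
  by rewrite sumr_const -[leLHS]mulr_natr ler_wpM2l ?ler_nat // ltW // mulr_gt0.
have [O0w wU] : w \in O0 /\ [disjoint supp w & U] by move: O1w; rewrite inE => /andP[].
have disj_w v : v \in M -> [disjoint supp v & supp w].
  move=> Mv; rewrite disjoint_sym; apply: disjointWr wU; exact: bigcup_sup.
have wM : w \notin M.
  apply/negP=> /disj_w; rewrite -setI_eq0 setIid; exact/negP.
exists (w |: M); split.
- by rewrite subUset sub1set O0w.
- move=> u v /setU1P[->|Mu] /setU1P[->|Mv]; rewrite ?eqxx // => uv.
  + by rewrite disjoint_sym disj_w.
  + exact: disj_w.
  exact: Mdisj.
- rewrite big_setU1 //= (leq_trans (leq_card_setU _ _)) // mulSn leq_add //.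
(* The new member halves the potential of exactly the targets that it absorbs. *)
have potE a : 2^-1 ^+ #|[set v in w |: M | abs v a]| =
    pot a - (if abs w a then pot a / 2 else 0).
  case: ifP => wa; last first.
    rewrite subr0 /pot; congr (_ ^+ #|pred_of_set _|); apply/setP=> v.
    by rewrite !inE; case: eqP => [->|//]; rewrite wa (negPf wM).
  have -> : [set v in w |: M | abs v a] = w |: [set v in M | abs v a].
    by apply/setP=> v; rewrite !inE; case: eqP => [->|//]; rewrite wa.
  rewrite cardsU1 inE (negPf wM) /= add1n exprS -/(pot a).
  by move: (pot a) => x; lra.
under eq_bigr do rewrite potE.
rewrite sumrB -big_mkcondr /= -mulr_suml -/S -/(gain w).
rewrite exprSr mulrA.
have d1 : 0 <= 1 - delta / 2 by move: delta_le1; lra.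
apply: le_trans (ler_wpM2r d1 leS).
by move: gain_w; clear leS sum_gain; lra.
Qed.

End GreedyFamily.

(** * Packable sets and absorbing grids *)

Section Packing.
Variables (S T : finType) (k : nat) (F : kgraph S k) (H : kgraph T k).

Definition copy_on (B : {set T}) : Prop :=
  exists G : kgraph T k, [/\ subkgraph G H, kgraph_iso F G & verts G = B].

(** Adding one disjoint copy at a time lets unions be treated by induction; the explicit partition
    is extracted once, at the end. *)
Inductive packable : {set T} -> Prop :=
| packable0 : packable set0
| packableU1 (B X : {set T}) : copy_on B -> [disjoint B & X] -> packable X ->
    packable (B :|: X).

Lemma card_copy B : copy_on B -> #|B| = #|verts F|.
Proof.
by case=> G [_ [f [f_inj fV _]] <-]; rewrite -fV card_in_imset.
Qed.

Lemma packable_partition X : verts F != set0 -> packable X ->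
  exists P : {set {set T}}, partition P X /\ {in P, forall B, copy_on B}.
Proof.
move=> F0; elim=> [|B Y cB BY _ [P [partP cP]]].
  exists set0; split=> [|B]; last by rewrite inE.
  by rewrite /partition /trivIset /cover !big_set0 cards0 inE !eqxx.
exists (B |: P); split=> [|C /setU1P[->//|/cP//]].
apply: partitionU1 => //; rewrite -card_gt0 (card_copy cB) card_gt0 //.
Qed.

Lemma packable_copy (B : {set T}) : copy_on B -> packable B.
Proof.
move=> cB; rewrite -[B]setU0; apply: packableU1 => //; last exact: packable0.
by rewrite -setI_eq0 setI0.
Qed.

Lemma packableU X X' : packable X -> packable X' -> [disjoint X & X'] ->
  packable (X :|: X').
Proof.
move=> pX pX'; elim: pX => [|B Y cB BY _ IH]; first by rewrite set0U.
rewrite -setI_eq0 setIUl setU_eq0 !setI_eq0 => /andP[BX' YX'].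
rewrite -setUA; apply: packableU1 => //; last exact: IH.
by rewrite -setI_eq0 setIUr setU_eq0 !setI_eq0 BY.
Qed.

Lemma packable_card X : packable X -> #|verts F| %| #|X|.
Proof.
elim=> [|B Y cB /disjoint_setI0 BY _ IH]; first by rewrite cards0 dvdn0.
by rewrite cardsU BY cards0 subn0 (card_copy cB) dvdn_addr.
Qed.

Lemma packable_bigcup (I : finType) (D : {set I}) (B : I -> {set T}) :
  {in D, forall i, packable (B i)} ->
  {in D &, forall i j, i != j -> [disjoint B i & B j]} ->
  packable (\bigcup_(i in D) B i).
Proof.
have [n] := ubnP #|D|; elim: n D => [//|n IHn] D; rewrite ltnS => cD pB disjB.
have [->|[i Di]] := set_0Vmem D; first by rewrite big_set0; apply: packable0.
rewrite (big_setD1 i) //=; apply: packableU; first exact: pB.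
  apply: IHn => [|j /setD1P[_ /pB]//|j j' /setD1P[_ Dj] /setD1P[_ Dj']].
    by move: cD; rewrite (cardsD1 i) Di.
  exact: disjB.
rewrite -setI_eq0; apply/eqP/setP=> v; rewrite in_set0; apply/negP.
case/setIP=> iv /bigcupP[j /setD1P[ji Dj] jv].
by have := disjB _ _ Dj Di ji; rewrite -setI_eq0 => /eqP/setP/(_ v); rewrite !inE iv jv.
Qed.

Lemma copy_of_map (h : S -> T) : {in verts F &, injective h} ->
  h @: verts F \subset verts H ->
  {in edges F, forall e : {set S}, h @: e \in edges H} ->
  copy_on (h @: verts F).
Proof.
move=> h_inj hV hE.
have GP e' : e' \in [set h @: (e : {set S}) | e in edges F] ->
    (e' \subset h @: verts F) && (#|e'| == k).
  case/imsetP=> e Fe ->; case/andP: (edgesP Fe) => eV /eqP ck.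
  rewrite imsetS //= card_in_imset ?ck //; apply: sub_in2 h_inj.
  exact: (subsetP eV).
exists (KGraph GP); split=> //; last by exists h.
by split=> //=; apply/subsetP=> _ /imsetP[e Fe ->]; apply: hE.
Qed.

Variable x0 : S.
Hypothesis Fx0 : x0 \in verts F.
Implicit Types (a : {ffun S -> T}) (w : {ffun S * S -> T}).

Definition grid_col w (z y : S) : T := w (y, z).
(** The target [a] takes the place of the column [x0], so that [a y] plays the root in the row
    [y]. *)
Definition grid_row a w (y z : S) : T := if z == x0 then a y else w (y, z).

Definition good_grid w : bool :=
  [&& injectiveb w, w \in ffun_on (verts H)
    & [forall z, [forall e : {set S} in edges F, grid_col w z @: e \in edges H]]].

Definition absorbs w a : bool :=
  [forall y, [forall e : {set S} in edges F, grid_row a w y @: e \in edges H]].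

(** The vertices that the gadget contributes to a packing, while [w] itself is a map on all of
    [S * S]. *)
Definition grid w : {set T} := w @: setX (verts F) (verts F :\ x0).

Lemma packable_grid w : good_grid w -> packable (grid w).
Proof.
case/and3P=> /injectiveP w_inj /ffun_onP wV /forallP wE.
have -> : grid w = \bigcup_(z in verts F :\ x0) (grid_col w z @: verts F).
  apply/setP=> v; apply/imsetP/bigcupP => [[[y z]]|[z Fz /imsetP[y Fy ->]]].
    by rewrite in_setX => /andP[Fy Fz] ->; exists z => //; apply/imsetP; exists y.
  by exists (y, z); rewrite // in_setX Fy.
apply: packable_bigcup => [z Fz|z z' _ _ zz'].
  apply: packable_copy; apply: copy_of_map => [y y' _ _ /w_inj[]//||e Fe].
    by apply/subsetP=> _ /imsetP[y _ ->]; apply: wV.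
  by have /forall_inP := wE z; apply.
rewrite -setI_eq0; apply/eqP/setP=> v; rewrite !inE; apply/negP.
by case/andP=> /imsetP[y _ ->] /imsetP[y' _ /w_inj[_ eqz]]; rewrite eqz eqxx in zz'.
Qed.

(** The array is cut into rows instead of columns, and each row is completed by one vertex of the
    target. *)
Lemma packable_absorb w a : good_grid w -> absorbs w a ->
  {in verts F &, injective a} -> a @: verts F \subset verts H ->
  [disjoint a @: verts F & grid w] -> packable (a @: verts F :|: grid w).
Proof.
case/and3P=> /injectiveP w_inj /ffun_onP wV _ /forallP awE a_inj aV aw.
have a_neq_w y y' z : y \in verts F -> y' \in verts F -> z \in verts F ->
    z != x0 -> a y <> w (y', z).
  move=> Fy Fy' Fz zx0 eq_aw; move: aw; rewrite -setI_eq0 => /eqP/setP/(_ (a y)).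
  by rewrite !inE imset_f //= eq_aw imset_f // in_setX !inE Fy' zx0.
have row_inj y y' z z' : y \in verts F -> y' \in verts F -> z \in verts F ->
    z' \in verts F -> grid_row a w y z = grid_row a w y' z' -> y = y' /\ z = z'.
  move=> Fy Fy' Fz Fz'; rewrite /grid_row.
  case: eqP => [->|/eqP zx]; case: eqP => [->|/eqP zx'].
  - by move/a_inj->.
  - by move/a_neq_w; case.
  - by move/esym/a_neq_w; case.
  by move/w_inj=> [-> ->].
have -> : a @: verts F :|: grid w = \bigcup_(y in verts F) (grid_row a w y @: verts F).
  apply/setP=> v; rewrite inE; apply/orP/bigcupP => [[/imsetP[y Fy ->]|]|].
  - by exists y => //; apply/imsetP; exists x0; rewrite // /grid_row eqxx.
  - case/imsetP=> -[y z]; rewrite in_setX => /andP[/= Fy /setD1P[zx Fz]] ->.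
    by exists y => //; apply/imsetP; exists z; rewrite // /grid_row (negPf zx).
  case=> y Fy /imsetP[z Fz ->]; rewrite /grid_row; case: eqP => [zx|/eqP zx].
    by left; rewrite imset_f.
  by right; rewrite imset_f // in_setX Fy !inE zx.
apply: packable_bigcup => [y Fy|y y' Fy Fy' yy'].
  apply: packable_copy; apply: copy_of_map => [z z' Fz Fz' /row_inj[]//||e Fe].
    apply/subsetP=> _ /imsetP[z _ ->]; rewrite /grid_row; case: ifP => _ //.
    by apply: (subsetP aV); rewrite imset_f.
  by have /forall_inP := awE y; apply.
rewrite -setI_eq0; apply/eqP/setP=> v; rewrite !inE; apply/negP.
case/andP=> /imsetP[z Fz ->] /imsetP[z' Fz' /row_inj[]// eqy].
by rewrite eqy eqxx in yy'.
Qed.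

(** Each batch of [#|verts F|] vertices of [W] consumes one member of [M], which costs every other
    target at most one absorber. The members left at the end are packed by columns. *)
Lemma packable_leftover q (M : {set {ffun S * S -> T}}) (W : {set T}) :
  {in M, forall w, good_grid w} ->
  {in M &, forall v w, v != w -> [disjoint grid v & grid w]} ->
  {in M, forall w, [disjoint W & grid w]} ->
  W \subset verts H -> #|W| = q * #|verts F| ->
  (forall a, a \in ffun_on W -> q <= #|[set w in M | absorbs w a]|) ->
  packable (W :|: \bigcup_(w in M) grid w).
Proof.
elim: q M W => [|q IHq] M W good Mdisj WM WH cW many.
  rewrite (cards0_eq cW) set0U; apply: packable_bigcup => // w Mw.
  exact/packable_grid/good.
have F_gt0 : 0 < #|verts F| by apply/card_gt0P; exists x0.
have F_le : #|verts F| <= #|W| by rewrite cW mulSn leq_addr.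
have [v0 Wv0] : exists v, v \in W.
  by apply/card_gt0P; apply: leq_trans F_le.
(* The batch consists of the first vertices of [W]; [v0] is a filler off [verts F]. *)
pose a : {ffun S -> T} := [ffun y => if y \in verts F then
   nth v0 (enum W) (index y (enum (verts F))) else v0].
have aE y : y \in verts F -> a y = nth v0 (enum W) (index y (enum (verts F))).
  by rewrite ffunE => ->.
have idx y : y \in verts F -> index y (enum (verts F)) < size (enum W).
  by move=> Fy; rewrite -cardE (leq_trans _ F_le) // cardE index_mem mem_enum.
have aW y : a y \in W.
  rewrite ffunE; case: ifP => // Fy; rewrite -(mem_enum W) mem_nth //.
  exact: idx.
have a_inj : {in verts F &, injective a}.
  move=> y y' Fy Fy'; rewrite !aE // => /eqP; rewrite nth_uniq ?enum_uniq ?idx //.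
  move=> /eqP eqi; rewrite -[y](nth_index y (s := enum (verts F))) ?mem_enum //.
  by rewrite eqi nth_index ?mem_enum.
have aV : a @: verts F \subset W by apply/subsetP=> _ /imsetP[y _ ->].
have [w] : exists w, w \in [set w in M | absorbs w a].
  by apply/card_gt0P; apply: leq_trans (many a _) => //; apply/ffun_onP.
rewrite inE => /andP[Mw aw].
have -> : W :|: \bigcup_(v in M) grid v = (a @: verts F :|: grid w) :|:
    ((W :\: a @: verts F) :|: \bigcup_(v in M :\ w) grid v).
  rewrite (big_setD1 w) //= -{1}(setID W (a @: verts F)) (setIidPr aV).
  by rewrite setUACA.
apply: packableU.
- apply: packable_absorb => //; first exact: good.
    exact: subset_trans WH.
  exact: disjointWl (WM _ Mw).
- apply: IHq.
  + by move=> v /setD1P[_ /good].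
  + by move=> u v /setD1P[_ Mu] /setD1P[_ Mv]; apply: Mdisj.
  + move=> v /setD1P[_ Mv]; apply: disjointWl (WM _ Mv); exact: subsetDl.
  + exact: subset_trans (subsetDl _ _) WH.
  + rewrite cardsD (setIidPr aV) card_in_imset // cW mulSn addKn //.
  move=> a' /ffun_onP a'W; rewrite -ltnS.
  apply: leq_trans (many a' _) _.
    by apply/ffun_onP=> y; case/setDP: (a'W y).
  rewrite -add1n; apply: leq_trans (_ : _ <= #|w |: [set v in M :\ w | absorbs v a']|) _.
    apply/subset_leq_card/subsetP=> v; rewrite !inE => /andP[-> ->].
    by case: eqP.
  by rewrite cardsU1 leq_add2r leq_b1.
rewrite -setI_eq0; apply/eqP/setP=> v; rewrite !inE; apply/negP.
case/andP=> /orP[av|gv] /orP[/andP[nav Wv]|/bigcupP[u /setD1P[uw Mu] gu]].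
- by rewrite av in nav.
- have := WM _ Mu; rewrite -setI_eq0 => /eqP/setP/(_ v).
  by rewrite !inE gu (subsetP aV).
- have := WM _ Mw; rewrite -setI_eq0 => /eqP/setP/(_ v).
  by rewrite !inE gv Wv.
have := Mdisj _ _ Mu Mw uw; rewrite -setI_eq0 => /eqP/setP/(_ v).
by rewrite !inE gu gv.
Qed.

End Packing.

(** * Rooted and unrooted embeddings *)

Lemma labelling_inverse (S : finType) (k : nat) (A : {set S}) (phi : S -> 'I_k) :
  labelling A phi ->
  exists e : 'I_k -> S, [/\ forall t, e t \in A, cancel e phi
                          & {in A, cancel phi e}].
Proof.
case=> phi_inj phiA.
have /fin_all_exists[e eP] (t : 'I_k) : exists y, (y \in A) && (phi y == t).
  have : t \in phi @: A by rewrite phiA in_setT.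
  by case/imsetP=> y Ay ->; exists y; rewrite Ay eqxx.
exists e; split=> [t|t|y Ay]; first by case/andP: (eP t).
  by case/andP: (eP t) => _ /eqP.
by apply: phi_inj => //; case/andP: (eP (phi y)) => // _ /eqP.
Qed.

Lemma unrooted_embedding (S : finType) (k : nat) (A : {set S}) (phi : S -> 'I_k) :
  labelling A phi ->
  exists e : 'I_k -> S, [/\ injective e, [set e t | t : 'I_k] = A & cancel e phi].
Proof.
case/labelling_inverse=> e [eA eK Ae]; exists e; split=> //; first exact: can_inj eK.
apply/setP=> y; apply/imsetP/idP => [[t _ ->//]|Ay].
by exists (phi y); rewrite ?Ae.
Qed.

(* The first edge of the ordering may contain the root with an arbitrary
   label; a transposition moves that label to [k.-1]. *)
Lemma rooted_embedding (S : finType) (k : nat) (A : {set S}) (psi : S -> 'I_k) x :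
  labelling A psi -> x \in A ->
  exists e : 'I_k.-1 -> S,
    [/\ injective e, [set e t | t : 'I_k.-1] = A :\ x
      & psi x = k.-1 :> nat ->
        forall t, psi (e t) = widen_ord (leq_pred k) t].
Proof.
case: k psi => [|k] psi; first by case: (psi x).
move=> lab Ax; pose s := tperm (psi x) ord_max; pose psi' y := s (psi y).
have lab' : labelling A psi'.
  case: lab => psi_inj psiA; split=> [y z Ay Az /perm_inj/psi_inj->//|].
  apply/setP=> t; rewrite in_setT; apply/imsetP.
  have : (s^-1)%g t \in psi @: A by rewrite psiA in_setT.
  by case/imsetP=> y Ay ty; exists y; rewrite // /psi' -ty permKV.
have psi'x : psi' x = ord_max by rewrite /psi' tpermL.
have [e' [e'A e'K Ae']] := labelling_inverse lab'.
pose w (t : 'I_k) : 'I_k.+1 := widen_ord (leq_pred k.+1) t.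
have w_inj : injective w by move=> t t' /(congr1 val) /= eqt; apply: val_inj.
exists (e' \o w); split.
- by apply: inj_comp w_inj; apply: can_inj e'K.
- apply/setP=> y; rewrite in_setD1; apply/imsetP/andP => [[t _ ->] /=|[yx Ay]].
    split; last exact: e'A.
    apply/eqP=> ex; have := e'K (w t); rewrite ex psi'x.
    by move/(congr1 val) => /= kt; have := ltn_ord t; rewrite -kt ltnn.
  have lt_k : psi' y < k.
    rewrite ltn_neqAle -ltnS ltn_ord andbT; apply: contra yx => /eqP psi'y.
    by rewrite -(Ae' _ Ay) -(Ae' _ Ax) psi'x; apply/eqP; congr e'; apply: val_inj.
  exists (Ordinal lt_k) => //=; rewrite -[LHS](Ae' _ Ay).
  by congr e'; apply: val_inj.
move=> psix t /=; have := e'K (w t).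
rewrite {1}/psi' /s (_ : psi x = ord_max); last exact: val_inj.
by rewrite tperm1 perm1.
Qed.

Lemma congr_in (T : finType) (A A' : {set T}) (D : {set {set T}}) :
  A = A' -> (A \in D) = (A' \in D).
Proof. by move->. Qed.

(** * Counting copies and absorbing grids *)

Section Counting.
Variables (R : realType) (S T : finType) (k : nat).
Variables (F : kgraph S k) (H : kgraph T k).
Variables (II : {set {set 'I_k}}) (JJ : {set {set 'I_k.-1}}) (q eta : R).
Local Open Scope ring_scope.
Hypotheses (q01 : 0 <= q <= 1) (eta0 : 0 <= eta).
Local Notation m := #|edges F|.

Lemma count_copies (W : {set T}) :
  adapted II F -> (0 < #|W|)%N -> odisc II q eta W (edges H) ->
  q ^+ m * (#|W| ^ #|S|)%:R - m%:R * eta * (#|W| ^ #|S|)%:R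
    <= #|[set g : {ffun S -> T} in ffun_on W |
           [forall e : {set S} in edges F, g @: e \in edges H]]|%:R.
Proof.
move=> [E [phi [[E_inj EF] lab adapt]]] W0 od.
pose C i (g : {ffun S -> T}) := g @: E i \in edges H.
have := @count_embed R T S 'I_m W q eta E C val q01 eta0 W0 _ _.
rewrite card_ord => /(_ _ _)/le_trans; apply.
- by move=> j g g' eqg; rewrite /C (eq_in_imset eqg).
- move=> j; have [e [e_inj eE eK]] := unrooted_embedding (lab j).
  exists k, e, II, (edges H); split=> // [g|j' j'j le_j'j].
    by rewrite /C -eE -imset_comp; apply: congr_in; apply: eq_imset.
  have [I II_I subI] : exists2 I, I \in II & phi j @: (E j' :&: E j) \subset I.
    by apply: adapt; rewrite ltn_neqAle j'j.
  exists I => // t Et; apply: (subsetP subI); rewrite -[t]eK imset_f // inE Et.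
  by rewrite -eE imset_f.
rewrite ler_nat; apply/subset_leq_card/subsetP=> g; rewrite !in_set.
case/andP=> -> /forallP Cg; apply/forall_inP=> e; rewrite -EF => /imsetP[i _ ->].
exact: Cg.
Qed.

Variable x0 : S.

(** Rows follow the rooted ordering [E], columns the ordering provided by [adapted]. As [a] is
    fixed, a row edge through [x0] becomes a constraint in the link of [a y]. *)
Lemma count_grids (a : {ffun S -> T}) (V := verts H)
    (m' := #|{: S * 'I_m + S * 'I_m}|) (N : R := (#|V| ^ #|{: S * S}|)%:R)
    (E : 'I_m -> {set S}) (psi : 'I_m -> S -> 'I_k) :
  (0 < k)%N -> full_antichain II -> adapted II F -> edge_ordering E ->
  (forall i, labelling (E i) (psi i)) ->
  (forall j i : 'I_m, (j < i)%N ->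
     (x0 \notin E i ->
        exists2 I, I \in II & psi i @: (E j :&: E i) \subset I) /\
     (x0 \in E i ->
        psi i x0 = k.-1 :> nat /\
        exists2 J, J \in JJ &
          psi i @: ((E j :&: E i) :\ x0) \subset widen_ord (leq_pred k) @: J)) ->
  (0 < #|V|)%N -> odisc II q eta V (edges H) ->
  (forall x, x \in V -> odisc JJ q eta V (link_edges H x)) ->
  a \in ffun_on V ->
  q ^+ m' * N - m'%:R * eta * N
    <= #|[set w : {ffun S * S -> T} in ffun_on V |
           [forall z, [forall e : {set S} in edges F, grid_col w z @: e \in edges H]]
             & absorbs F H x0 w a]|%:R.
Proof.
move=> k0 [_ _ full] [E2 [phi [[_ E2F] lab2 adapt2]]] [_ EF] lab adapt V0 od odl aV.
have [I0 II_I0 _] := full (Ordinal k0).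
pose Z (j : S * 'I_m + S * 'I_m) : {set S * S} := match j with
  | inl (y, i) => [set u | (u.1 == y) && (u.2 \in E i :\ x0)]
  | inr (z, i) => [set u | (u.2 == z) && (u.1 \in E2 i)] end.
pose C (j : S * 'I_m + S * 'I_m) (w : {ffun S * S -> T}) : bool := match j with
  | inl (y, i) => [set w (y, z) | z in E i :\ x0] \in
                    (if x0 \in E i then link_edges H (a y) else edges H)
  | inr (z, i) => grid_col w z @: E2 i \in edges H end.
(* All row edges precede all column edges, so column constraints never interfere with a row edge. *)
pose rank (j : S * 'I_m + S * 'I_m) : nat := match j with
  | inl (_, i) => i | inr (_, i) => m + i end.
have := @count_embed R T _ _ V q eta Z C rank q01 eta0 V0 _ _.
move=> /(_ _ _)/le_trans; apply.
- move=> [[y i]|[z i]] w w' eqw; rewrite /C.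
    apply: congr_in; apply: eq_in_imset => z Ez; apply: eqw.
    by rewrite inE eqxx.
  apply: congr_in; apply: eq_in_imset => y Ey; apply: eqw.
  by rewrite inE eqxx.
- move=> [[y i]|[z i]]; last first.
    have [e [e_inj eE eK]] := unrooted_embedding (lab2 i).
    exists k, (fun t => (e t, z)), II, (edges H); split=> //.
    + by move=> t t' [/e_inj].
    + move=> w; rewrite /C -eE -imset_comp; apply: congr_in; exact: eq_imset.
    move=> [[y' i']|[z' i']] neq /=.
      (* A row and a column share at most one vertex, whose index lies in a member of [II] by
         fullness; [I0] serves an empty trace. *)
      move=> _; case: (pickP (fun t => e t == y')) => [t0 /eqP et0|none].
        have [I II_I It0] := full t0; exists I => // t; rewrite inE /= -et0.
        by case/andP=> /eqP/e_inj->.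
      by exists I0 => // t; rewrite inE /= none.
    rewrite leq_add2l => le_i; have [zz'|zz'] := eqVneq z z'; last first.
      by exists I0 => // t; rewrite inE /= (negPf zz').
    have lt_i : (i' < i)%N.
      rewrite ltn_neqAle le_i andbT; apply: contra neq => /eqP ii'.
      by rewrite zz' (val_inj ii').
    have [I II_I subI] := adapt2 _ _ lt_i.
    exists I => // t; rewrite inE /= => /andP[_ Et].
    by apply: (subsetP subI); rewrite -[t]eK imset_f // inE Et -eE imset_f.
  case: (boolP (x0 \in E i)) => [Ex0|Ex0].
    have [e [e_inj eE eK]] := rooted_embedding (lab i) Ex0.
    (* The added [set0] receives the edges of the other rows, which are disjoint from this one. *)
    exists k.-1, (fun t => (y, e t)), (set0 |: JJ), (link_edges H (a y)); split.
    + by move=> t t' [/e_inj].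
    + by apply: odisc_set0 => //; apply: odl; apply: (ffun_onP aV).
    + move=> w; rewrite /C Ex0 -eE -imset_comp; apply: congr_in; exact: eq_imset.
    move=> [[y' i']|[z' i']] neq /= le_i; last first.
      by have := leq_trans (leq_addr i' m) le_i; rewrite leqNgt ltn_ord.
    have [yy'|yy'] := eqVneq y y'; last first.
      by exists set0; [rewrite setU11 | move=> t; rewrite inE /= (negPf yy')].
    have lt_i : (i' < i)%N.
      rewrite ltn_neqAle le_i andbT; apply: contra neq => /eqP ii'.
      by rewrite yy' (val_inj ii').
    have [_ /(_ Ex0)[psix0 [J JJ_J subJ]]] := adapt _ _ lt_i.
    exists J; first by rewrite setU1r.
    move=> t; rewrite inE /= => /andP[_ /setD1P[ex0 Et]].
    have : psi i (e t) \in widen_ord (leq_pred k) @: J.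
      apply: (subsetP subJ); rewrite imset_f // !inE ex0 Et /=.
      have : e t \in E i :\ x0 by rewrite -eE imset_f.
      by case/setD1P.
    rewrite eK // => /imsetP[t' Jt' /(congr1 val) /= tt'].
    by rewrite (val_inj tt').
  have [e [e_inj eE eK]] := unrooted_embedding (lab i).
  have ED : E i :\ x0 = E i.
    by apply/setP=> z; rewrite !inE; case: eqP => // ->; rewrite (negPf Ex0).
  exists k, (fun t => (y, e t)), II, (edges H); split=> //.
  + by move=> t t' [/e_inj].
  + move=> w; rewrite /C (negPf Ex0) ED -eE -imset_comp.
    by apply: congr_in; exact: eq_imset.
  move=> [[y' i']|[z' i']] neq /= le_i; last first.
    by have := leq_trans (leq_addr i' m) le_i; rewrite leqNgt ltn_ord.
  have [yy'|yy'] := eqVneq y y'; last first.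
    by exists I0 => // t; rewrite inE /= (negPf yy').
  have lt_i : (i' < i)%N.
    rewrite ltn_neqAle le_i andbT; apply: contra neq => /eqP ii'.
    by rewrite yy' (val_inj ii').
  have [/(_ Ex0)[I II_I subI] _] := adapt _ _ lt_i.
  exists I => // t; rewrite inE /= => /andP[_ /setD1P[_ Et]].
  by apply: (subsetP subI); rewrite -[t]eK imset_f // inE Et -eE imset_f.
rewrite ler_nat; apply/subset_leq_card/subsetP=> w; rewrite !in_set.
case/andP=> -> /forallP Cw /=; apply/andP; split.
  apply/forallP=> z; apply/forall_inP=> e; rewrite -E2F => /imsetP[i _ ->].
  exact: (Cw (inr (z, i))).
apply/forallP=> y; apply/forall_inP=> e; rewrite -EF => /imsetP[i _ ->].
have := Cw (inl (y, i)); rewrite /C; case: ifPn => Ex0.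
  (* Putting [a y] back turns the link edge into an edge of [H]. *)
  rewrite inE => /andP[_]; rewrite (congr_in (A' := grid_row x0 a w y @: E i)) //.
  rewrite -[in RHS](setD1K Ex0) imsetU1 /grid_row eqxx; congr (_ |: _).
  by apply: eq_in_imset => z /setD1P[/negPf->].
rewrite (congr_in (A' := grid_row x0 a w y @: E i)) //; have -> : E i :\ x0 = E i.
  by apply/setP=> z; rewrite !inE; case: eqP => // ->; rewrite (negPf Ex0).
apply: eq_in_imset => z Ez; rewrite /grid_row; case: eqP => // zx0.
by rewrite zx0 (negPf Ex0) in Ez.
Qed.

End Counting.

(** * The packing *)

Section Absorption.
Variables (S T : finType) (k : nat) (F : kgraph S k) (H : kgraph T k).

Lemma greedy_cover (c : nat) (X : {set T}) : 0 < #|verts F| ->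
  (forall W : {set T}, W \subset X -> c < #|W| ->
     exists2 B : {set T}, B \subset W & copy_on F H B) ->
  exists W : {set T},
    [/\ W \subset X, #|W| <= c & packable F H (X :\: W)].
Proof.
move=> F0; have [n] := ubnP #|X|; elim: n X => [//|n IHn] X; rewrite ltnS => cX copies.
have [le_X|lt_X] := leqP #|X| c.
  by exists X; rewrite setDv; split=> //; apply: packable0.
have [B BX cB] := copies X (subxx _) lt_X.
have [||W [WX cW pW]] := IHn (X :\: B).
- apply: leq_trans cX; rewrite cardsD (setIidPr BX) (card_copy cB).
  by rewrite -subn_gt0 subKn // -(card_copy cB) subset_leq_card.
- by move=> W WX; apply: copies; apply: subset_trans WX (subsetDl _ _).
exists W; split=> //; first exact: subset_trans WX (subsetDl _ _).
have -> : X :\: W = B :|: ((X :\: B) :\: W).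
  apply/setP=> v; rewrite !inE; case: (boolP (v \in B)) => //= Bv.
  rewrite (subsetP BX) // andbT; apply/negP=> /(subsetP WX).
  by rewrite inE Bv.
apply: packableU1 => //; rewrite -setI_eq0; apply/eqP/setP=> v; rewrite !inE.
by case: (v \in B); rewrite //= andbF.
Qed.

Variables (R : realType) (x0 : S) (delta : R) (L D : nat).
Hypotheses (Fx0 : x0 \in verts F) (delta01 : (0 < delta <= 1)%R).
Hypothesis L_large : ((1 - delta / 2) ^+ L <= 4^-1)%R.
Local Notation V := (verts H).
Local Notation n := #|V|.
Hypotheses (n_gt0 : 0 < n) (n_large : n ^ #|S| <= 2 ^ (n %/ D)).
Hypothesis many : forall (U : {set T}) (a : {ffun S -> T}),
  #|U| <= L * (n %/ D) * #|{: S * S}| -> a \in ffun_on V ->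
  (delta * (n ^ #|{: S * S}|)%:R
    <= #|[set w in [set w | good_grid F H w] | absorbs F H x0 w a
            && [disjoint w @: [set: S * S] & U]]|%:R)%R.

(** Run the greedy choice for [L * (n %/ D)] steps. The bound on the potential starts at
    [n ^ #|S| <= 2 ^ (n %/ D)] and every [L] steps shrink it by a factor 4, so it ends below
    [2 ^- (n %/ D)] or equal to it, which forces [n %/ D] absorbers for every target. *)
Lemma absorbing_family :
  exists M : {set {ffun S * S -> T}},
    [/\ {in M, forall w, good_grid F H w},
        {in M &, forall v w, v != w -> [disjoint grid F x0 v & grid F x0 w]}
      & forall a, a \in ffun_on V ->
          n %/ D <= #|[set w in M | absorbs F H x0 w a]|].
Proof.
have /andP[d0 d1] := delta01.
pose A0 : {set {ffun S -> T}} := [set a in ffun_on V].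
have cA0 : #|A0| = n ^ #|S| by rewrite cardsE card_ffun_on.
have := @greedy_family R _ _ T (fun w : {ffun S * S -> T} => w @: [set: S * S])
  (absorbs F H x0) [set w | good_grid F H w] A0 (n ^ #|{: S * S}|)
  #|{: S * S}| (L * (n %/ D) * #|{: S * S}|) delta _ _ d0 d1 _ _ _
  (L * (n %/ D))%N (leqnn _).
case.
- by rewrite expn_gt0 n_gt0.
- rewrite -card_ffun_on; apply/subset_leq_card/subsetP=> w.
  by rewrite inE => /and3P[].
- by move=> w; apply/set0Pn; exists (w (x0, x0)); rewrite imset_f.
- by move=> w; rewrite -cardsT leq_imset_card.
- by move=> U a cU; rewrite inE; apply: many.
move=> M [MO Mdisj _ leM]; exists M; split=> [w /(subsetP MO)|v w Mv Mw vw|a aV].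
- by rewrite inE.
- have := Mdisj _ _ Mv Mw vw.
  by apply: disjointW; apply: imsetS; apply: subsetT.
have le_a : (2^-1 ^+ #|[set w in M | absorbs F H x0 w a]| <= 2^-1 ^+ (n %/ D) :> R)%R.
  apply: (@le_trans _ _ (#|A0|%:R * (1 - delta / 2) ^+ (L * (n %/ D)))%R).
    apply: le_trans leM; rewrite [leRHS](bigD1 a) ?inE //= lerDl.
    by apply: sumr_ge0 => *; rewrite exprn_ge0 // invr_ge0.
  rewrite exprM; apply: (@le_trans _ _ ((2 ^ (n %/ D))%:R * 4^-1 ^+ (n %/ D))%R).
    apply: ler_pM; rewrite ?ler0n ?ler_nat ?cA0 //.
      by rewrite !exprn_ge0 //; move: d1; lra.
    by rewrite lerXn2r ?nnegrE ?exprn_ge0 //; move: d1; lra.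
  by rewrite natrX -exprMn (_ : 2 * 4^-1 = 2^-1 :> R)%R //; field.
move: le_a; apply: contraTT; rewrite -ltnNge -ltNge => lt_a.
by rewrite ltr_iXn2l // ?invr_gt0 // invf_lt1 // ltr1n.
Qed.

Hypothesis copies : forall W : {set T}, W \subset V -> n %/ D < #|W| ->
  exists2 B : {set T}, B \subset W & copy_on F H B.

Lemma packable_verts : #|verts F| %| n -> packable F H V.
Proof.
move=> dvd_n; have [M [Mgood Mdisj Mmany]] := absorbing_family.
set G := \bigcup_(w in M) grid F x0 w.
have pG : packable F H G.
  by apply: packable_bigcup => // w Mw; apply: packable_grid; apply: Mgood.
have GV : G \subset V.
  apply/bigcupsP=> w /Mgood/and3P[_ /ffun_onP wV _].
  by apply/subsetP=> _ /imsetP[u _ ->].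
have F0 : 0 < #|verts F| by apply/card_gt0P; exists x0.
have [|W [WV cW pW]] := @greedy_cover (n %/ D) (V :\: G) F0.
  by move=> W WV; apply: copies; apply: subset_trans WV (subsetDl _ _).
have WG : [disjoint W & G].
  by move: WV; rewrite subsetD => /andP[].
have WV' : W \subset V by apply: subset_trans WV (subsetDl _ _).
have VE : V = (W :|: G) :|: ((V :\: G) :\: W).
  apply/setP=> v; rewrite !inE.
  case: (boolP (v \in W)) => [/(subsetP WV')->//|_].
  by case: (boolP (v \in G)) => [/(subsetP GV)->//|_].
have dW1 : [disjoint W :|: G & (V :\: G) :\: W].
  rewrite -setI_eq0; apply/eqP/setP=> v; rewrite !inE.
  by case: (v \in W); case: (v \in G).
(* All other vertices are already packed, so their number is divisible too. *)
have dvd_W : #|verts F| %| #|W|.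
  move: dvd_n; rewrite VE cardsU (disjoint_setI0 dW1) cards0 subn0.
  rewrite dvdn_addl ?(packable_card pW) // cardsU (disjoint_setI0 WG) cards0 subn0.
  by rewrite dvdn_addl ?(packable_card pG).
rewrite VE; apply: packableU => //.
apply: (packable_leftover Fx0 (q := #|W| %/ #|verts F|)) => //.
- by move=> w Mw; apply: disjointWr WG; apply: bigcup_sup.
- by rewrite divnK.
(* The number of batches is at most [#|W|], hence at most the number [n %/ D] of absorbers of each
   target. *)
move=> a aW; apply: leq_trans (leq_trans (leq_div _ _) cW) (Mmany _ _).
by apply/ffun_onP=> y; apply: (subsetP WV'); apply: (ffun_onP aW).
Qed.

End Absorption.

(** * Numerical thresholds *)

Section Thresholds.
Variable R : realType.
Local Open Scope ring_scope.

Lemma eventually_small (x y : R) : 0 < y ->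
  exists n0 : nat, forall n : nat, (n0 <= n)%N -> (0 < n)%N -> x / n%:R <= y.
Proof.
move=> y0; exists (Num.truncn (x / y)).+1 => n le_n n0.
rewrite ler_pdivrMr ?ltr0n // mulrC -ler_pdivrMr // ltW //.
by apply: lt_le_trans (truncnS_gt _) _; rewrite ler_nat.
Qed.

Lemma exp_below (x : R) : 0 < x <= 1 ->
  exists L : nat, (1 - x) ^+ L <= 4^-1.
Proof.
move=> /andP[x0 x1].
(* A reciprocal form of Bernoulli's inequality; [L > 3 / x] then makes the second factor at least
   4. *)
have bern L : (1 - x) ^+ L * (1 + L%:R * x) <= 1.
  elim: L => [|L IHL]; first by rewrite expr0 mul0r addr0 mulr1.
  apply: le_trans IHL; rewrite exprSr -mulrA ler_wpM2l ?exprn_ge0 ?subr_ge0 //.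
  rewrite -natr1; have : 0 <= L%:R * x * x by rewrite !mulr_ge0 // ltW.
  have := mulr_gt0 x0 x0; lra.
exists (Num.truncn (3 / x)).+1; set L := _.+1.
have Lx : 4 <= 1 + L%:R * x.
  by have := truncnS_gt (3 / x); rewrite -/L ltr_pdivrMr //; lra.
have le4 : (1 - x) ^+ L * 4 <= 1.
  by apply: le_trans (bern L); rewrite ler_wpM2l ?exprn_ge0 ?subr_ge0.
by rewrite -[leRHS]mul1r ler_pdivlMr.
Qed.

Lemma poly_le_exp (s D : nat) : (0 < D)%N ->
  exists n0 : nat, forall n : nat, (n0 <= n)%N -> (n ^ s <= 2 ^ (n %/ D))%N.
Proof.
case: s => [|s] D0; first by exists 0%N => n _; rewrite expn0 expn_gt0.
(* For [v = n %/ c], this [c] gives [2 * v * s.+1 <= n %/ D], and the threshold gives [n <= v * v],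
   hence [n <= 2 ^ (2 * v)]. *)
pose c := (2 * s.+1 * D)%N; exists (2 * c * c)%N => n le_n.
have c0 : (0 < c)%N by rewrite !muln_gt0.
pose v := (n %/ c)%N.
have le_v : (2 * c <= v)%N by rewrite leq_divRL.
have n_lt : (n < v.+1 * c)%N by rewrite -ltn_divLR.
have le_n2 : (n <= v * v)%N.
  apply: ltnW; apply: leq_trans n_lt _; apply: leq_trans (_ : v * (2 * c) <= _)%N.
    rewrite mulnA leq_mul2r; apply/orP; right.
    by rewrite muln2 -addnn -addn1 leq_add2l (leq_trans _ le_v) // muln_gt0.
  by rewrite leq_mul2l le_v orbT.
apply: (@leq_trans ((2 ^ v * 2 ^ v) ^ s.+1)%N).
  rewrite leq_exp2r //; apply: leq_trans le_n2 _.
  by apply: leq_mul; apply: ltnW; apply: ltn_expl.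
rewrite -expnD -expnM leq_exp2l // leq_divRL //.
apply: leq_trans (leq_divM n c); rewrite -/v /c.
by rewrite addnn -muln2 -!mulnA.
Qed.

End Thresholds.

Lemma quarter_bounds (R : realType) (x : R) : (0 < x <= 1)%R ->
  (0 < x / 4 / 2 <= 1)%R /\ (0 < x / 4 <= 1)%R.
Proof. by move=> /andP[x0 x1]; split; apply/andP; split; lra. Qed.

(** One quarter each goes to the discrepancy error, the non-injective maps and the maps hitting a
    forbidden set; one quarter survives. *)
Lemma remaining_fraction (R : realType) (x y z A B N1 N2 : R) :
  (y - z <= A -> x <= y -> z <= x / 4 -> A <= B + N1 + N2 ->
   N1 <= x / 4 -> N2 <= x / 4 -> x / 4 <= B)%R.
Proof. by lra. Qed.

(** * Copies inside large sets, and abundance of absorbers *)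

Section Existence.
Variables (R : realType) (S T : finType) (k : nat).
Variables (F : kgraph S k) (H : kgraph T k).
Variables (II : {set {set 'I_k}}) (JJ : {set {set 'I_k.-1}}).
Variables (q eta kappa : R).
Local Open Scope ring_scope.
Hypotheses (q01 : 0 <= q <= 1) (eta0 : 0 <= eta) (kappa0 : 0 < kappa).
Local Notation m := #|edges F|.

Lemma bad_fraction (Y : finType) (W : {set T}) (b c : nat) (e : R) :
  (0 < #|W|)%N -> (b * #|W| <= c * #|W| ^ #|Y|)%N -> c%:R / #|W|%:R <= e ->
  b%:R <= e * (#|W| ^ #|Y|)%:R :> R.
Proof.
move=> W0; rewrite -(ler_nat R) !natrM => le_b le_e.
have WR : 0 < #|W|%:R :> R by rewrite ltr0n.
rewrite -(ler_pM2r WR) (le_trans le_b) // mulrAC ler_wpM2r ?ler0n //.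
by rewrite -ler_pdivrMr.
Qed.

Lemma copy_in (W : {set T}) :
  adapted II F -> W \subset verts H -> (0 < #|W|)%N ->
  odisc II q eta W (edges H) -> kappa <= q ^+ m ->
  m%:R * eta <= kappa / 4 -> (#|S| ^ 2)%:R / #|W|%:R <= kappa / 4 ->
  exists2 B : {set T}, B \subset W & copy_on F H B.
Proof.
move=> adapt WV W0 od le_k le_eta le_inj.
have := count_copies q01 eta0 adapt W0 od; set A := [set g in _ | _].
set N : R := (_ ^ _)%:R => leA.
have N0 : 0 < N by rewrite ltr0n expn_gt0 W0.
have leN1 := bad_fraction W0 (card_not_injective S W) le_inj.
set N1 := [set g in _ | _] in leN1.
(* There are more edge-preserving maps than non-injective maps. *)
have [g Ag gN1] : exists2 g, g \in A & g \notin N1.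
  apply/subsetPn; apply/negP=> /subset_leq_card; rewrite -(ler_nat R) => AN1.
  have x0 : 0 < kappa / 4 * N by rewrite mulr_gt0 ?divr_gt0.
  have leA' : #|A|%:R <= 0 + #|N1|%:R + 0 :> R by rewrite add0r addr0.
  have := remaining_fraction leA (ler_wpM2r (ltW N0) le_k) _ leA'.
  rewrite [kappa * N / 4]mulrAC => /(_ (ler_wpM2r (ltW N0) le_eta) leN1 (ltW x0)).
  by rewrite leNgt x0.
move: Ag; rewrite in_set => /andP[gW gE].
have g_inj : injective g.
  by apply/injectiveP; move: gN1; rewrite in_set gW negbK.
have gV : g @: verts F \subset W.
  by apply/subsetP=> _ /imsetP[y _ ->]; apply: (ffun_onP gW).
exists (g @: verts F) => //; apply: copy_of_map => [y y' _ _ /g_inj//||].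
  exact: subset_trans WV.
by move=> e Fe; move/forall_inP: gE; apply.
Qed.

Variable x0 : S.
Local Notation V := (verts H).
Local Notation m' := #|{: S * 'I_m + S * 'I_m}|.

Lemma many_absorbers (b : nat) (U : {set T}) (a : {ffun S -> T})
    (E : 'I_m -> {set S}) (psi : 'I_m -> S -> 'I_k) :
  (0 < k)%N -> full_antichain II -> adapted II F -> edge_ordering E ->
  (forall i, labelling (E i) (psi i)) ->
  (forall j i : 'I_m, (j < i)%N ->
     (x0 \notin E i ->
        exists2 I, I \in II & psi i @: (E j :&: E i) \subset I) /\
     (x0 \in E i ->
        psi i x0 = k.-1 :> nat /\
        exists2 J, J \in JJ &
          psi i @: ((E j :&: E i) :\ x0) \subset widen_ord (leq_pred k) @: J)) ->
  (0 < #|V|)%N -> odisc II q eta V (edges H) ->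
  (forall x, x \in V -> odisc JJ q eta V (link_edges H x)) ->
  kappa <= q ^+ m' -> m'%:R * eta <= kappa / 4 ->
  (#|{: S * S}| ^ 2)%:R / #|V|%:R <= kappa / 4 ->
  (#|{: S * S}| * b)%:R / #|V|%:R <= kappa / 4 ->
  (#|U| <= b)%N -> a \in ffun_on V ->
  kappa / 4 * (#|V| ^ #|{: S * S}|)%:R
    <= #|[set w in [set w | good_grid F H w] | absorbs F H x0 w a
            && [disjoint w @: [set: S * S] & U]]|%:R.
Proof.
move=> k0 full adapt EF lab adapt' V0 od odl le_k le_eta le_inj le_b cU aV.
set B := [set w in _ | _ && _]; set N : R := (_ ^ _)%:R.
have := count_grids q01 eta0 k0 full adapt EF lab adapt' V0 od odl aV.
set A := [set w in _ | _ & _]; rewrite -/N => leA.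
have N0 : 0 < N by rewrite ltr0n expn_gt0 V0.
have leN1 := bad_fraction V0 (card_not_injective _ V) le_inj.
set N1 := [set g in _ | _] in leN1.
have hitU : (#|[set g : {ffun S * S -> T} in ffun_on V | [exists y, g y \in U]]|
    * #|V| <= #|{: S * S}| * b * #|V| ^ #|{: S * S}|)%N.
  apply: leq_trans (card_hitting _ V U) _.
  by rewrite leq_mul2r leq_mul2l cU !orbT.
have leN2 := bad_fraction V0 hitU le_b.
set N2 := [set g in _ | _] in leN2.
have AB : #|A|%:R <= #|B|%:R + #|N1|%:R + #|N2|%:R :> R.
  rewrite -!natrD ler_nat.
  apply: leq_trans (leq_trans (leq_card_setU (B :|: N1) N2) _); last first.
    by rewrite leq_add2r leq_card_setU.
  apply/subset_leq_card/subsetP=> w; rewrite in_set => /and3P[wV wc wa].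
  rewrite 2!in_setU ![w \in [set _ | _]]in_set /good_grid wV wc wa /= andbT.
  case: (boolP (injectiveb w)) => //= w_inj; rewrite orbF orbC.
  case: (boolP [exists y, w y \in U]) => //= /existsPn wU.
  rewrite -setI_eq0; apply/eqP/setP=> v; rewrite in_set0; apply/negP.
  by case/setIP=> /imsetP[y _ ->]; apply/negP.
have := remaining_fraction leA (ler_wpM2r (ltW N0) le_k) _ AB.
rewrite [kappa * N / 4]mulrAC.
exact: (fun f => f (ler_wpM2r (ltW N0) le_eta) leN1 leN2).
Qed.

End Existence.

Theorem theorem6 (R : realType) (k : nat) (hk : 2 <= k)
    (II : {set {set 'I_k}}) (hII : full_antichain II)
    (JJ : {set {set 'I_k.-1}})
    (alpha p : R) (halpha : (0 < alpha < 1)%R) (hp : (0 < p < 1)%R)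
    (S : finType) (F : kgraph S k) (hF : adapted2 II JJ F) :
  exists (mu : R) (n0 : nat), (0 < mu)%R /\
    forall (T : finType) (n : nat) (H : kgraph T k),
      #|verts H| = n -> n0 <= n -> #|verts F| %| n ->
      Disc II p mu H ->
      (forall x : T, x \in verts H -> Disc JJ alpha mu (link H x)) ->
      perfect_packing F H.
Proof.
case: hF => adapt [x0 [E [psi [Fx0 EF lab adapt']]]].
case/andP: halpha => alpha0 alpha1; case/andP: hp => p0 p1.
have k0 : 0 < k by apply: leq_trans hk.
(* This is where [k >= 2] enters: the links have positive uniformity. *)
have k10 : 0 < k.-1 by rewrite -ltnS prednK.
pose q := Num.min alpha p.
have q0 : (0 < q)%R by rewrite lt_min alpha0.
have q1 : (q <= 1)%R by rewrite ge_min (ltW alpha1).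
have q01 : (0 <= q <= 1)%R by rewrite ltW.
pose m := #|edges F|; pose m' := #|{: S * 'I_m + S * 'I_m}|.
(* One lower bound for both densities: [q ^+ m] for copies and [q ^+ m'] for grids. *)
pose kappa : R := (q ^+ (m + m'))%R.
have kappa0 : (0 < kappa)%R by rewrite exprn_gt0.
have kappa_m : (kappa <= q ^+ m)%R by rewrite ler_wiXn2l ?leq_addr // ltW.
have kappa_m' : (kappa <= q ^+ m')%R by rewrite ler_wiXn2l ?leq_addl // ltW.
have kappa1 : (kappa <= 1)%R by rewrite exprn_ile1 // ltW.
have [delta2 delta01] : (0 < kappa / 4 / 2 <= 1)%R /\ (0 < kappa / 4 <= 1)%R.
  by apply: quarter_bounds; rewrite kappa0.
pose delta := (kappa / 4)%R.
have delta0 : (0 < delta)%R by rewrite divr_gt0.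
have [L le_L] := exp_below delta2.
pose s2 := #|{: S * S}|.
(* [D] is so large that at most a fraction [delta] of the grids hits the [L * (n %/ D) * s2]
   vertices that the greedy choice may occupy. *)
have [D1 D1P] := eventually_small (s2 * (L * s2))%:R%R delta0.
pose D := D1.+1.
have D0 : 0 < D by [].
have le_D : ((s2 * (L * s2))%:R / D%:R <= delta)%R by apply: D1P.
(* The factor [D ^ k] allows for restriction to sets of more than [n %/ D] vertices; [(m + m').+1]
   keeps the accumulated errors below [delta]. *)
pose eta := (delta / ((m + m').+1%:R * (D ^ k)%:R))%R.
have Dk0 : (0 < (D ^ k)%:R :> R)%R by rewrite ltr0n expn_gt0.
have Dk1 : (1 <= (D ^ k)%:R :> R)%R by rewrite ler1n expn_gt0.
have mm0 : (0 < (m + m').+1%:R :> R)%R by rewrite ltr0n.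
have eta0 : (0 < eta)%R by rewrite divr_gt0 // mulr_gt0.
have etaE : ((m + m').+1%:R * (eta * (D ^ k)%:R) = delta)%R.
  by rewrite mulrCA mulrA -mulrA divfK // gt_eqF ?mulr_gt0.
have le_m c : c <= m + m' -> (c%:R * (eta * (D ^ k)%:R) <= delta)%R.
  move=> le_c; rewrite -etaE; apply: ler_wpM2r.
    by rewrite mulr_ge0 // ltW.
  by rewrite ler_nat (leq_trans le_c).
have kk0 : (0 < (k ^ k)%:R :> R)%R by rewrite ltr0n expn_gt0 k0.
(* Half of [eta] pays for the colouring loss [k ^ k], the other half, through [n1], for degenerate
   tuples. *)
pose mu := (eta / 2 / (k ^ k)%:R)%R.
have mu0 : (0 < mu)%R by apply: divr_gt0 kk0; apply: divr_gt0.
have eta2 : (0 < eta / 2)%R by rewrite divr_gt0.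
have [n1 n1P] := eventually_small (k ^ 2 + k)%:R%R eta2.
have [n2 n2P] := eventually_small (s2 ^ 2)%:R%R delta0.
(* The factor [D] appears because copies are sought in sets of size only about [n / D]. *)
have [n3 n3P] := eventually_small (#|S| ^ 2 * D)%:R%R delta0.
have [n4 n4P] := poly_le_exp #|S| D0.
exists mu, (n1 + n2 + n3 + n4).+1; split=> // T n H cH le_n dvd_n disc discl.
have n_gt0 : 0 < n by apply: leq_trans le_n.
have {le_n} [le1 le2 le3 le4] : [/\ n1 <= n, n2 <= n, n3 <= n & n4 <= n].
  split; apply: leq_trans (ltnW le_n).
  - by rewrite -!addnA leq_addr.
  - by rewrite -!addnA addnCA leq_addr.
  - by rewrite addnAC leq_addl.
  exact: leq_addl.
have V0 : 0 < #|verts H| by rewrite cH.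
have od : odisc II q eta (verts H) (edges H).
  apply: (odisc_weaken (Disc_odisc k0 (ltW mu0) _ disc (subxx _) _ V0)).
  - by rewrite !ltW.
  - by rewrite setDv cards0.
  - by rewrite ge_min lexx orbT.
  rewrite cH /mu divfK ?gt_eqF // [leRHS]splitr lerD2l; exact: n1P.
have odl x : x \in verts H -> odisc JJ q eta (verts H) (link_edges H x).
  move=> Hx.
  apply: (odisc_weaken (Disc_odisc k10 (ltW mu0) _ (discl x Hx) (subsetDl _ _) _ V0)).
  - by rewrite !ltW.
  - rewrite /= setDDr setDv set0U; apply: leq_trans (subset_leq_card (subsetIr _ _)) _.
    by rewrite cards1.
  - by rewrite ge_min lexx.
  have le_kk : (mu * (k.-1 ^ k.-1)%:R <= mu * (k ^ k)%:R)%R.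
    apply: ler_wpM2l (ltW mu0) _ _ _; rewrite ler_nat; apply: (@leq_trans (k ^ k.-1)).
      by rewrite leq_exp2r // leq_pred.
    by rewrite leq_pexp2l // leq_pred.
  have le_k2 : ((k.-1 ^ 2 + k.-1)%:R / n%:R <= (k ^ 2 + k)%:R / n%:R :> R)%R.
    rewrite ler_wpM2r ?invr_ge0 // ler_nat leq_add ?leq_pred //.
    by rewrite leq_exp2r // leq_pred.
  rewrite cH [leRHS]splitr; apply: lerD; last exact: le_trans le_k2 (n1P _ le1 _).
  by apply: le_trans le_kk _; rewrite /mu divfK ?gt_eqF.
suff pV : packable F H (verts H).
  have F_neq0 : verts F != set0 by apply/set0Pn; exists x0.
  have [P [partP cP]] := packable_partition F_neq0 pV.
  by exists P; split=> // B /cP.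
have large (W : {set T}) : n %/ D < #|W| -> n < #|W| * D by rewrite ltn_divLR.
apply: (@packable_verts _ _ _ F H R x0 delta L D) => //; rewrite ?cH //.
- exact: n4P.
- move=> U a cU aV.
  have := @many_absorbers R S T k F H II JJ q eta kappa q01 (ltW eta0) x0
    (L * (n %/ D) * s2) U a E psi k0 hII adapt EF lab adapt' V0 od odl kappa_m'.
  rewrite cH; apply=> //.
  + apply: le_trans (le_m m' (leq_addl _ _)); rewrite ler_wpM2l //.
    by rewrite ler_peMr // ltW.
  + exact: n2P.
  have nR : (0 < n%:R :> R)%R by rewrite ltr0n.
  apply: le_trans le_D; rewrite ler_pdivrMr // mulrAC ler_pdivlMr ?ltr0n //.
  rewrite -!natrM ler_nat -/s2.
  rewrite (_ : s2 * (L * (n %/ D) * s2) * D = s2 * (L * s2) * (n %/ D * D)).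
    by rewrite leq_mul2l leq_divM orbT.
  by rewrite -!mulnA; congr (_ * (_ * _)); rewrite mulnCA; congr (_ * _);
     rewrite mulnC -mulnA mulnC.
move=> W WV /large lt_W.
have W0 : 0 < #|W| by case: #|W| lt_W.
have WR : (0 < #|W|%:R :> R)%R by rewrite ltr0n.
have nR : (0 < n%:R :> R)%R by rewrite ltr0n.
apply: (@copy_in R S T k F H II q (eta * (D ^ k)%:R) kappa) => //.
- by rewrite mulr_ge0 ?ltW.
- case: hII => _ _ full; apply: odisc_subset od => //.
  rewrite -mulrA; apply: ler_wpM2l (ltW eta0) _ _ _; rewrite -natrM ler_nat cH -expnMn.
  by rewrite leq_exp2r // mulnC ltnW.
- exact: le_m (leq_addr _ _).
apply: le_trans (n3P _ le3 n_gt0); rewrite ler_pdivrMr // mulrAC ler_pdivlMr //.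
by rewrite -!natrM ler_nat -mulnA leq_mul2l mulnC ltnW ?orbT.
Qed.
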